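(* The CCV $\lambda\mu$-calculus has the Church–Rosser property: if $M_1=_{ccv}M_2$, then there is a term $N$ with $M_1\to^* N$ and $M_2\to^* N$.
   Context: CCV $\lambda\mu$-calculus. Ordinary variables $x,y,z,\dots$ and continuation variables $k,l,\dots$ form disjoint sets. Terms $M ::= x \mid \lambda x.M \mid MM \mid (M\ \mathsf{where}\ x:=M) \mid \mu k.J$, jumps $J ::= [k]M \mid (J\ \mathsf{where}\ x:=M)$, where $(L\ \mathsf{where}\ x:=M)$ means $\mathsf{let}\ x=M\ \mathsf{in}\ L$; $\lambda x$ binds $x$ in its body, $\mathsf{where}\ x:=M$ binds $x$ in the body $L$ (or $J$) only, $\mu k$ binds $k$. Terms are identified up to $\alpha$-conversion and the congruence generated by (E1) $(L\ \mathsf{where}\ x:=(M\ \mathsf{where}\ y:=N))=((L\ \mathsf{where}\ x:=M)\ \mathsf{where}\ y:=N)$ if $y$ not free in $L$; (E2) $((\mu k.J)\ \mathsf{where}\ x:=M)=\mu k.(J\ \mathsf{where}\ x:=M)$ if $k$ not free in $M$; (E3) $[k](L\ \mathsf{where}\ x:=M)=([k]L\ \mathsf{where}\ x:=M)$. Values $V$: variables and $\lambda$-abstractions; $N$ denotes a non-value. Reduction rules ($z$ fresh): $NM\to(zM\ \mathsf{where}\ z:=N)$; $VN\to(Vz\ \mathsf{where}\ z:=N)$; $(\lambda x.M)V\to(M\ \mathsf{where}\ x:=V)$; $(M\ \mathsf{where}\ x:=V)\to M\{V/x\}$; $(M\ \mathsf{where}\ x:=\mu k.J)\to\mu k.J\{[k]\square\mapsto[k](M\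 \mathsf{where}\ x:=\square)\}$; $[l]\mu k.J\to J\{l/k\}$; $\lambda x.Vx\to V$ ($x$ not free in $V$); $(x\ \mathsf{where}\ x:=M)\to M$; $\mu k.[k]M\to M$ ($k$ not free in $M$). Here $J\{[k]\square\mapsto[k](M\ \mathsf{where}\ x:=\square)\}$ replaces recursively each subjump $[k]Q$ with $k$ free by $[k](M\ \mathsf{where}\ x:=Q)$ (capture-avoiding) and $J\{l/k\}$ replaces each such $[k]Q$ by $[l]Q$. $\to$ is the compatible closure, $\to^*$ its reflexive-transitive closure, and $=_{ccv}$ the smallest congruence containing the rules. *)

(* Defs.v *)
(* CCV lambda-mu calculus with de Bruijn indices.
   Two separate index spaces: ordinary (term) variables and continuation
   variables.  alpha-conversion is built in by the de Bruijn representation. *)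
From Stdlib Require Import Arith Relations.

(* Where L M  represents  (L where x := M)   -- x is term index 0 in L.
   Mu J       represents  mu k. J            -- k is continuation index 0 in J.
   Jmp k M    represents  [k] M.
   JWhere J M represents  (J where x := M)   -- x is term index 0 in J. *)
Inductive term : Type :=
| Var : nat -> term
| Lam : term -> term
| App : term -> term -> term
| Where : term -> term -> term
| Mu : jump -> term
with jump : Type :=
| Jmp : nat -> term -> jump
| JWhere : jump -> term -> jump.

Definition is_value (t : term) : bool :=
  match t with Var _ | Lam _ => true | _ => false end.

Fixpoint shift_t (c : nat) (t : term) : term :=
  match t with
  | Var n => Var (if c <=? n then S n else n)
  | Lam M => Lam (shift_t (S c) M)
  | App M N => App (shift_t c M) (shift_t c N)
  | Where L M => Where (shift_t (S c) L) (shift_t c M)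
  | Mu J => Mu (shift_tj c J)
  end
with shift_tj (c : nat) (J : jump) : jump :=
  match J with
  | Jmp k M => Jmp k (shift_t c M)
  | JWhere J M => JWhere (shift_tj (S c) J) (shift_t c M)
  end.

Fixpoint shift_k (c : nat) (t : term) : term :=
  match t with
  | Var n => Var n
  | Lam M => Lam (shift_k c M)
  | App M N => App (shift_k c M) (shift_k c N)
  | Where L M => Where (shift_k c L) (shift_k c M)
  | Mu J => Mu (shift_kj (S c) J)
  end
with shift_kj (c : nat) (J : jump) : jump :=
  match J with
  | Jmp k M => Jmp (if c <=? k then S k else k) (shift_k c M)
  | JWhere J M => JWhere (shift_kj c J) (shift_k c M)
  end.

(* capture-avoiding substitution of s for ordinary variable j
   (variables above j are decremented: the binder of j disappears) *)
Fixpoint subst_t (j : nat) (s : term) (t : term) : term :=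
  match t with
  | Var n => if n =? j then s else if j <? n then Var (pred n) else Var n
  | Lam M => Lam (subst_t (S j) (shift_t 0 s) M)
  | App M N => App (subst_t j s M) (subst_t j s N)
  | Where L M => Where (subst_t (S j) (shift_t 0 s) L) (subst_t j s M)
  | Mu J => Mu (subst_tj j (shift_k 0 s) J)
  end
with subst_tj (j : nat) (s : term) (J : jump) : jump :=
  match J with
  | Jmp k M => Jmp k (subst_t j s M)
  | JWhere J M => JWhere (subst_tj (S j) (shift_t 0 s) J) (subst_t j s M)
  end.

(* J{l/k}: rename continuation variable j into l (variables above j are
   decremented: the binder of j disappears) *)
Fixpoint rename_k (j l : nat) (t : term) : term :=
  match t with
  | Var n => Var n
  | Lam M => Lam (rename_k j l M)
  | App M N => App (rename_k j l M) (rename_k j l N)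
  | Where L M => Where (rename_k j l L) (rename_k j l M)
  | Mu J => Mu (rename_kj (S j) (S l) J)
  end
with rename_kj (j l : nat) (J : jump) : jump :=
  match J with
  | Jmp k M =>
      Jmp (if k =? j then l else if j <? k then pred k else k) (rename_k j l M)
  | JWhere J M => JWhere (rename_kj j l J) (rename_k j l M)
  end.

(* structural substitution  J{[k]Q |-> [k](M where x := Q)}, k = continuation
   index e; M has x as ordinary index 0.  Applied recursively inside Q. *)
Fixpoint ssub_t (e : nat) (M : term) (t : term) : term :=
  match t with
  | Var n => Var n
  | Lam P => Lam (ssub_t e (shift_t 1 M) P)
  | App P Q => App (ssub_t e M P) (ssub_t e M Q)
  | Where P Q => Where (ssub_t e (shift_t 1 M) P) (ssub_t e M Q)
  | Mu J => Mu (ssub_j (S e) (shift_k 0 M) J)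
  end
with ssub_j (e : nat) (M : term) (J : jump) : jump :=
  match J with
  | Jmp k Q =>
      if k =? e then Jmp k (Where M (ssub_t e M Q)) else Jmp k (ssub_t e M Q)
  | JWhere J Q => JWhere (ssub_j e (shift_t 1 M) J) (ssub_t e M Q)
  end.

Inductive eq_ax_t : term -> term -> Prop :=
| E1 : forall L M N,                       (* y not free in L *)
    eq_ax_t (Where L (Where M N)) (Where (Where (shift_t 1 L) M) N)
| E2 : forall J M,                         (* k not free in M *)
    eq_ax_t (Where (Mu J) M) (Mu (JWhere J (shift_k 0 M))).

Inductive eq_ax_j : jump -> jump -> Prop :=
| E1j : forall J M N,
    eq_ax_j (JWhere J (Where M N)) (JWhere (JWhere (shift_tj 1 J) M) N)
| E3 : forall k L M,
    eq_ax_j (Jmp k (Where L M)) (JWhere (Jmp k L) M).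

Inductive ec_t : term -> term -> Prop :=
| ec_ax : forall M N, eq_ax_t M N -> ec_t M N
| ec_lam : forall M M', ec_t M M' -> ec_t (Lam M) (Lam M')
| ec_appl : forall M M' N, ec_t M M' -> ec_t (App M N) (App M' N)
| ec_appr : forall M N N', ec_t N N' -> ec_t (App M N) (App M N')
| ec_wherel : forall L L' M, ec_t L L' -> ec_t (Where L M) (Where L' M)
| ec_wherer : forall L M M', ec_t M M' -> ec_t (Where L M) (Where L M')
| ec_mu : forall J J', ec_j J J' -> ec_t (Mu J) (Mu J')
with ec_j : jump -> jump -> Prop :=
| ecj_ax : forall J J', eq_ax_j J J' -> ec_j J J'
| ecj_jmp : forall k M M', ec_t M M' -> ec_j (Jmp k M) (Jmp k M')
| ecj_wherel : forall J J' M, ec_j J J' -> ec_j (JWhere J M) (JWhere J' M)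
| ecj_wherer : forall J M M', ec_t M M' -> ec_j (JWhere J M) (JWhere J M').

Definition cong (M N : term) : Prop := clos_refl_sym_trans term ec_t M N.

Inductive step_t : term -> term -> Prop :=
| r_app_nv : forall N M, is_value N = false ->
    step_t (App N M) (Where (App (Var 0) (shift_t 0 M)) N)
| r_app_vn : forall V N, is_value V = true -> is_value N = false ->
    step_t (App V N) (Where (App (shift_t 0 V) (Var 0)) N)
| r_beta : forall M V, is_value V = true ->
    step_t (App (Lam M) V) (Where M V)
| r_where_val : forall M V, is_value V = true ->
    step_t (Where M V) (subst_t 0 V M)
| r_where_mu : forall M J,
    step_t (Where M (Mu J)) (Mu (ssub_j 0 (shift_k 0 M) J))
| r_eta : forall V, is_value V = true ->          (* x not free in V *)
    step_t (Lam (App (shift_t 0 V) (Var 0))) V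
| r_where_var : forall M,
    step_t (Where (Var 0) M) M
| r_mu_jmp : forall M,                            (* k not free in M *)
    step_t (Mu (Jmp 0 (shift_k 0 M))) M
| s_lam : forall M M', step_t M M' -> step_t (Lam M) (Lam M')
| s_appl : forall M M' N, step_t M M' -> step_t (App M N) (App M' N)
| s_appr : forall M N N', step_t N N' -> step_t (App M N) (App M N')
| s_wherel : forall L L' M, step_t L L' -> step_t (Where L M) (Where L' M)
| s_wherer : forall L M M', step_t M M' -> step_t (Where L M) (Where L M')
| s_mu : forall J J', step_j J J' -> step_t (Mu J) (Mu J')
with step_j : jump -> jump -> Prop :=
| r_jmp_mu : forall l J,
    step_j (Jmp l (Mu J)) (rename_kj 0 l J)
| sj_jmp : forall k M M', step_t M M' -> step_j (Jmp k M) (Jmp k M')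
| sj_wherel : forall J J' M, step_j J J' -> step_j (JWhere J M) (JWhere J' M)
| sj_wherer : forall J M M', step_t M M' -> step_j (JWhere J M) (JWhere J M').

Definition red (M N : term) : Prop :=
  exists M' N', cong M M' /\ step_t M' N' /\ cong N' N.

(* reflexive-transitive closure (reflexivity is modulo the identification) *)
Definition reds (M N : term) : Prop :=
  clos_refl_trans term (fun a b => red a b \/ cong a b) M N.

Definition ccv_eq (M N : term) : Prop :=
  clos_refl_sym_trans term (fun a b => step_t a b \/ cong a b) M N.

(* Main.v *)
(** A one-pass CPS translation, indexed by environments for both kinds of
    variables, sends a term and a continuation to a kernel calculus of values,
    jumps and continuations.  The structural congruence becomes equality there,
    and every reduction becomes convertibility for beta and eta, which is
    confluent because its parallel reduction has the diamond property.

    Conversely the kernel is read back into the source: a jump becomes a jump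
    and a continuation a context [[k](M where x := _)].  Every kernel reduction
    is simulated by source reductions, and every term reduces to the read-back
    of its translation; hence a common kernel reduct yields a common reduct.
    As a term does not reduce to [mu k.[k]M], the read-back has to contract such
    terms whenever possible, and the crux is that this contraction is compatible
    with reduction. *)
Require Import Defs.
From Stdlib Require Import Arith Relations Lia FunctionalExtensionality.

(* The two directions carry unequal burdens. The translation need only respect convertibility:
   [App (Lam M) V] and [Where M V] become kernel jumps of which, in general, neither reduces to the
   other, although both reduce to the same instance. The read-back must respect the direction of
   reduction, so its lemmas are reductions rather than equations.

   In the source every peak would have to be closed modulo E1, E2 and E3. The kernel avoids this by
   handing the body of a [where] to the bound term as its continuation, which flattens all nestings
   of [where] and [mu].

   A kernel abstraction binds a continuation and has a jump as its body, so reading it back puts a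
   [mu] under every lambda; this is where terms of the form mu k.[k]M come from. Contracting them is
   harmless because a jump is, up to congruence, a single [[k]M] with a well-defined head [k]. When
   [k] is not free in [M], the only step outside [M] occurs when [M] is itself a [mu], and it then
   leads back to the contracted term. *)
Scheme term_jump_ind := Induction for term Sort Prop
  with jump_term_ind := Induction for jump Sort Prop.
Combined Scheme term_jump_mutind from term_jump_ind, jump_term_ind.
Scheme step_tj_ind := Induction for step_t Sort Prop
  with step_jt_ind := Induction for step_j Sort Prop.
Combined Scheme step_mutind from step_tj_ind, step_jt_ind.
Scheme ec_tj_ind := Induction for ec_t Sort Prop
  with ec_jt_ind := Induction for ec_j Sort Prop.
Combined Scheme ec_mutind from ec_tj_ind, ec_jt_ind.

Ltac funext := apply functional_extensionality; intro.

(** * Simultaneous renaming and substitution *)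

Definition scons {A} (a : A) (f : nat -> A) (n : nat) : A :=
  match n with 0 => a | S m => f m end.

Definition idr (n : nat) : nat := n.
Definition upr (xi : nat -> nat) : nat -> nat := scons 0 (fun n => S (xi n)).

Lemma upr_idr : upr idr = idr.
Proof. funext. destruct x; reflexivity. Qed.

(** Renaming both index spaces at once makes [shift_t], [shift_k] and [rename_k] instances of one
    operation, so that their commutation laws become pointwise equations between functions. *)
Fixpoint ren (xi zeta : nat -> nat) (t : term) : term :=
  match t with
  | Var n => Var (xi n)
  | Lam M => Lam (ren (upr xi) zeta M)
  | App M N => App (ren xi zeta M) (ren xi zeta N)
  | Where L M => Where (ren (upr xi) zeta L) (ren xi zeta M)
  | Mu J => Mu (renj xi (upr zeta) J)
  end
with renj (xi zeta : nat -> nat) (J : jump) : jump :=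
  match J with
  | Jmp k M => Jmp (zeta k) (ren xi zeta M)
  | JWhere J M => JWhere (renj (upr xi) zeta J) (ren xi zeta M)
  end.

(* A continuation [(l, None)] stands for [l]_, and [(l, Some L)] for
   [l](L where x := _). *)
Definition kont : Type := (nat * option term)%type.

Definition fill (c : kont) (t : term) : jump :=
  match snd c with
  | None => Jmp (fst c) t
  | Some L => Jmp (fst c) (Where L t)
  end.

Definition renc (xi zeta : nat -> nat) (c : kont) : kont :=
  (zeta (fst c), option_map (ren (upr xi) zeta) (snd c)).

Definition idk (k : nat) : kont := (k, None).

Definition upt (s : nat -> term) : nat -> term :=
  scons (Var 0) (fun n => ren S idr (s n)).
Definition upk (c : nat -> kont) : nat -> kont :=
  scons (idk 0) (fun k => renc idr S (c k)).

(** A common generalisation of [subst_t] (with [c] trivial) and of the structural substitution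
    [ssub_t] (with [s] trivial). *)
Fixpoint gsub (s : nat -> term) (c : nat -> kont) (t : term) : term :=
  match t with
  | Var n => s n
  | Lam M => Lam (gsub (upt s) (fun k => renc S idr (c k)) M)
  | App M N => App (gsub s c M) (gsub s c N)
  | Where L M =>
      Where (gsub (upt s) (fun k => renc S idr (c k)) L) (gsub s c M)
  | Mu J => Mu (gsubj (fun n => ren idr S (s n)) (upk c) J)
  end
with gsubj (s : nat -> term) (c : nat -> kont) (J : jump) : jump :=
  match J with
  | Jmp k M => fill (c k) (gsub s c M)
  | JWhere J M =>
      JWhere (gsubj (upt s) (fun k => renc S idr (c k)) J) (gsub s c M)
  end.

Lemma ren_ren_mut :
  (forall t xi zeta xi' zeta',
    ren xi' zeta' (ren xi zeta t)
    = ren (fun n => xi' (xi n)) (fun k => zeta' (zeta k)) t) /\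
  (forall J xi zeta xi' zeta',
    renj xi' zeta' (renj xi zeta J)
    = renj (fun n => xi' (xi n)) (fun k => zeta' (zeta k)) J).
Proof.
  assert (E : forall xi xi',
    (fun n => upr xi' (upr xi n)) = upr (fun n => xi' (xi n))).
  { intros. funext. destruct x; reflexivity. }
  apply term_jump_mutind; intros; simpl; rewrite ?H, ?H0, ?E; reflexivity.
Qed.
Definition ren_ren := proj1 ren_ren_mut.
Definition renj_renj := proj2 ren_ren_mut.

Lemma ren_id_mut :
  (forall t, ren idr idr t = t) /\ (forall J, renj idr idr J = J).
Proof.
  apply term_jump_mutind; intros; simpl; rewrite ?upr_idr, ?H, ?H0; reflexivity.
Qed.
Definition ren_id := proj1 ren_id_mut.

Lemma ren_ren_comp t xi zeta xi' zeta' xi2 zeta2 :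
  (forall n, xi' (xi n) = xi2 n) -> (forall n, zeta' (zeta n) = zeta2 n) ->
  ren xi' zeta' (ren xi zeta t) = ren xi2 zeta2 t.
Proof.
  intros. rewrite ren_ren. f_equal; funext; auto.
Qed.

(** The form in which most commutations of shifts with other renamings are discharged: only
    pointwise equations remain. *)
Lemma ren_swap t xi zeta xi' zeta' xi2 zeta2 xi2' zeta2' :
  (forall n, xi' (xi n) = xi2' (xi2 n)) ->
  (forall n, zeta' (zeta n) = zeta2' (zeta2 n)) ->
  ren xi' zeta' (ren xi zeta t) = ren xi2' zeta2' (ren xi2 zeta2 t).
Proof.
  intros. rewrite !ren_ren. f_equal; funext; auto.
Qed.

Lemma renj_swap t xi zeta xi' zeta' xi2 zeta2 xi2' zeta2' :
  (forall n, xi' (xi n) = xi2' (xi2 n)) ->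
  (forall n, zeta' (zeta n) = zeta2' (zeta2 n)) ->
  renj xi' zeta' (renj xi zeta t) = renj xi2' zeta2' (renj xi2 zeta2 t).
Proof.
  intros. rewrite !renj_renj. f_equal; funext; auto.
Qed.

Lemma renc_swap c xi zeta xi' zeta' xi2 zeta2 xi2' zeta2' :
  (forall n, xi' (xi n) = xi2' (xi2 n)) ->
  (forall n, zeta' (zeta n) = zeta2' (zeta2 n)) ->
  renc xi' zeta' (renc xi zeta c) = renc xi2' zeta2' (renc xi2 zeta2 c).
Proof.
  intros H1 H2. destruct c as [l [L|]]; unfold renc; simpl; rewrite H2; [|reflexivity].
  do 2 f_equal. apply ren_swap; auto. intros [|n]; simpl; auto.
Qed.

Lemma renj_fill xi zeta c t :
  renj xi zeta (fill c t) = fill (renc xi zeta c) (ren xi zeta t).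
Proof. destruct c as [l [L|]]; reflexivity. Qed.

Lemma gsub_ren_mut :
  (forall t xi zeta s c,
    gsub s c (ren xi zeta t) = gsub (fun n => s (xi n)) (fun k => c (zeta k)) t) /\
  (forall J xi zeta s c,
    gsubj s c (renj xi zeta J) = gsubj (fun n => s (xi n)) (fun k => c (zeta k)) J).
Proof.
  assert (E : forall xi s, (fun n => upt s (upr xi n)) = upt (fun n => s (xi n))).
  { intros. funext. destruct x; reflexivity. }
  assert (E' : forall xi s, (fun n => upk s (upr xi n)) = upk (fun n => s (xi n))).
  { intros. funext. destruct x; reflexivity. }
  apply term_jump_mutind; intros; simpl; rewrite ?H, ?H0, ?E, ?E'; reflexivity.
Qed.
Definition gsub_ren := proj1 gsub_ren_mut.
Definition gsubj_renj := proj2 gsub_ren_mut.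

Lemma ren_gsub_mut :
  (forall t xi zeta s c,
    ren xi zeta (gsub s c t)
    = gsub (fun n => ren xi zeta (s n)) (fun k => renc xi zeta (c k)) t) /\
  (forall J xi zeta s c,
    renj xi zeta (gsubj s c J)
    = gsubj (fun n => ren xi zeta (s n)) (fun k => renc xi zeta (c k)) J).
Proof.
  assert (E : forall xi zeta s,
    (fun n => ren (upr xi) zeta (upt s n)) = upt (fun n => ren xi zeta (s n))).
  { intros. funext. destruct x; [reflexivity|]. simpl. apply ren_swap; reflexivity. }
  assert (E' : forall xi zeta (c : nat -> kont),
    (fun k => renc (upr xi) zeta (renc S idr (c k)))
    = (fun k => renc S idr (renc xi zeta (c k)))).
  { intros. funext. apply renc_swap; reflexivity. }
  assert (F : forall xi zeta (s : nat -> term),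
    (fun n => ren xi (upr zeta) (ren idr S (s n)))
    = (fun n => ren idr S (ren xi zeta (s n)))).
  { intros. funext. apply ren_swap; reflexivity. }
  assert (F' : forall xi zeta c,
    (fun k => renc xi (upr zeta) (upk c k)) = upk (fun k => renc xi zeta (c k))).
  { intros. funext. destruct x; [reflexivity|]. simpl. apply renc_swap; reflexivity. }
  apply term_jump_mutind; intros; simpl;
    rewrite ?renj_fill, ?H, ?H0, ?E, ?E', ?F, ?F'; reflexivity.
Qed.
Definition ren_gsub := proj1 ren_gsub_mut.
Definition renj_gsubj := proj2 ren_gsub_mut.

Lemma upt_Var : upt Var = Var.
Proof. funext. destruct x; reflexivity. Qed.
Lemma upk_idk : upk idk = idk.
Proof. funext. destruct x; reflexivity. Qed.

Lemma gsub_id_mut :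
  (forall t, gsub Var idk t = t) /\ (forall J, gsubj Var idk J = J).
Proof.
  assert (E : (fun k => renc S idr (idk k)) = idk) by reflexivity.
  apply term_jump_mutind; intros; simpl; rewrite ?upt_Var, ?upk_idk, ?E;
    fold idk; rewrite ?H, ?H0; try reflexivity.
  change (fun n => Var (idr n)) with Var. now rewrite H.
Qed.
Definition gsub_id := proj1 gsub_id_mut.
Definition gsubj_id := proj2 gsub_id_mut.

Lemma gsub_shift_t s c t :
  gsub (upt s) (fun k => renc S idr (c k)) (ren S idr t) = ren S idr (gsub s c t).
Proof. rewrite gsub_ren, ren_gsub. reflexivity. Qed.

Lemma gsub_shift_k s c t :
  gsub (fun n => ren idr S (s n)) (upk c) (ren idr S t) = ren idr S (gsub s c t).
Proof. rewrite gsub_ren, ren_gsub. reflexivity. Qed.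

(* The composite of two substitutions, [c'] after [c], is expressible as a
   substitution as long as no continuation receives two contexts. *)
Definition kcomp (s' : nat -> term) (c' : nat -> kont) (a b : kont) : Prop :=
  match snd a with
  | None => b = c' (fst a)
  | Some L => snd (c' (fst a)) = None /\
      b = (fst (c' (fst a)), Some (gsub (upt s') (fun k => renc S idr (c' k)) L))
  end.

Lemma kcomp_fill s' c' a b t :
  kcomp s' c' a b -> gsubj s' c' (fill a t) = fill b (gsub s' c' t).
Proof.
  destruct a as [l [L|]]; unfold kcomp, fill; simpl.
  - intros [E ->]. simpl. unfold fill. rewrite E. reflexivity.
  - intros ->. reflexivity.
Qed.

Lemma kcomp_shift_t s' c' a b :
  kcomp s' c' a b ->
  kcomp (upt s') (fun k => renc S idr (c' k)) (renc S idr a) (renc S idr b).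
Proof.
  destruct a as [l [L|]]; unfold kcomp; simpl.
  - change (idr l) with l. intros [E ->]. rewrite E. split; [reflexivity|].
    unfold renc at 1. simpl. do 2 f_equal.
    rewrite gsub_ren, ren_gsub. f_equal; funext; [destruct x; [reflexivity|]|].
    + simpl. apply ren_swap; reflexivity.
    + simpl. apply renc_swap; reflexivity.
  - intros ->. reflexivity.
Qed.

Lemma kcomp_shift_k s' c' a b :
  kcomp s' c' a b ->
  kcomp (fun n => ren idr S (s' n)) (upk c') (renc idr S a) (renc idr S b).
Proof.
  destruct a as [l [L|]]; unfold kcomp; simpl.
  - intros [E ->]. rewrite E. split; [reflexivity|].
    unfold renc at 1. simpl. do 2 f_equal.
    rewrite gsub_ren, ren_gsub. f_equal; funext; [destruct x; [reflexivity|]|].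
    + simpl. apply ren_swap; reflexivity.
    + simpl. apply renc_swap; reflexivity.
  - intros ->. reflexivity.
Qed.

Lemma gsub_gsub_mut :
  (forall t s c s' c' s2 c2,
    (forall n, gsub s' c' (s n) = s2 n) -> (forall k, kcomp s' c' (c k) (c2 k)) ->
    gsub s' c' (gsub s c t) = gsub s2 c2 t) /\
  (forall J s c s' c' s2 c2,
    (forall n, gsub s' c' (s n) = s2 n) -> (forall k, kcomp s' c' (c k) (c2 k)) ->
    gsubj s' c' (gsubj s c J) = gsubj s2 c2 J).
Proof.
  assert (E : forall (s : nat -> term) (c : nat -> kont) s' c' s2 (c2 : nat -> kont),
    (forall n, gsub s' c' (s n) = s2 n) -> (forall k, kcomp s' c' (c k) (c2 k)) ->
    (forall n, gsub (upt s') (fun k => renc S idr (c' k)) (upt s n) = upt s2 n) /\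
    (forall k, kcomp (upt s') (fun k => renc S idr (c' k))
                 (renc S idr (c k)) (renc S idr (c2 k)))).
  { intros s c s' c' s2 c2 H1 H2. split.
    - intros [|n]; [reflexivity|]. simpl. rewrite gsub_shift_t, H1. reflexivity.
    - intro k. apply kcomp_shift_t, H2. }
  apply term_jump_mutind; intros; simpl.
  - apply H.
  - destruct (E _ _ _ _ _ _ H0 H1). f_equal. now apply H.
  - f_equal; [now apply H | now apply H0].
  - destruct (E _ _ _ _ _ _ H1 H2). f_equal; [now apply H | now apply H0].
  - f_equal. apply H.
    + intro n. rewrite gsub_shift_k, H0. reflexivity.
    + intros [|k]; simpl; [reflexivity|]. apply kcomp_shift_k, H1.
  - erewrite kcomp_fill by apply H1. f_equal. now apply H.
  - destruct (E _ _ _ _ _ _ H1 H2). f_equal; [now apply H | now apply H0].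
Qed.
Definition gsubj_gsubj := proj2 gsub_gsub_mut.

(** * The cutoff-based operations as instances of [ren] and [gsub] *)

Lemma shift_t_ren_mut :
  (forall t c, shift_t c t = ren (fun n => if c <=? n then S n else n) idr t) /\
  (forall J c, shift_tj c J = renj (fun n => if c <=? n then S n else n) idr J).
Proof.
  assert (E : forall c, upr (fun n => if c <=? n then S n else n)
    = (fun n => if S c <=? n then S n else n)).
  { intro c. funext. destruct x; simpl; [reflexivity|]. now destruct (c <=? x). }
  apply term_jump_mutind; intros; simpl; rewrite ?upr_idr, ?H, ?H0, ?E; reflexivity.
Qed.

Lemma shift_k_ren_mut :
  (forall t c, shift_k c t = ren idr (fun n => if c <=? n then S n else n) t) /\
  (forall J c, shift_kj c J = renj idr (fun n => if c <=? n then S n else n) J).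
Proof.
  assert (E : forall c, upr (fun n => if c <=? n then S n else n)
    = (fun n => if S c <=? n then S n else n)).
  { intro c. funext. destruct x; simpl; [reflexivity|]. now destruct (c <=? x). }
  apply term_jump_mutind; intros; simpl; rewrite ?upr_idr, ?H, ?H0, ?E; reflexivity.
Qed.

Lemma shift_t0 t : shift_t 0 t = ren S idr t.
Proof. apply (proj1 shift_t_ren_mut). Qed.
Lemma shift_t1 t : shift_t 1 t = ren (upr S) idr t.
Proof. rewrite (proj1 shift_t_ren_mut). f_equal. funext. now destruct x. Qed.
Lemma shift_tj1 J : shift_tj 1 J = renj (upr S) idr J.
Proof. rewrite (proj2 shift_t_ren_mut). f_equal. funext. now destruct x. Qed.
Lemma shift_k0 t : shift_k 0 t = ren idr S t.
Proof. apply (proj1 shift_k_ren_mut). Qed.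

Lemma rename_k_ren_mut :
  (forall t j l, rename_k j l t
    = ren idr (fun k => if k =? j then l else if j <? k then pred k else k) t) /\
  (forall J j l, rename_kj j l J
    = renj idr (fun k => if k =? j then l else if j <? k then pred k else k) J).
Proof.
  assert (E : forall j l,
    upr (fun k => if k =? j then l else if j <? k then pred k else k)
    = (fun k => if k =? S j then S l else if S j <? k then pred k else k)).
  { intros. funext. destruct x; simpl; [reflexivity|]. destruct (x =? j); [reflexivity|].
    change (S j <? S x) with (j <? x). destruct (Nat.ltb_spec j x); lia. }
  apply term_jump_mutind; intros; simpl; rewrite ?upr_idr, ?H, ?H0, ?E; reflexivity.
Qed.

Lemma rename_kj0 l J : rename_kj 0 l J = renj idr (scons l idr) J.
Proof. rewrite (proj2 rename_k_ren_mut). f_equal. funext. now destruct x. Qed.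

Lemma subst_t_gsub_mut :
  (forall t j s, subst_t j s t
    = gsub (fun n => if n =? j then s else if j <? n then Var (pred n) else Var n)
        idk t) /\
  (forall J j s, subst_tj j s J
    = gsubj (fun n => if n =? j then s else if j <? n then Var (pred n) else Var n)
        idk J).
Proof.
  assert (E : forall j s,
    upt (fun n => if n =? j then s else if j <? n then Var (pred n) else Var n)
    = (fun n => if n =? S j then ren S idr s else if S j <? n then Var (pred n) else Var n)).
  { intros. funext. destruct x; simpl; [reflexivity|]. destruct (x =? j); [reflexivity|].
    change (S j <? S x) with (j <? x). destruct (Nat.ltb_spec j x); simpl; f_equal; lia. }
  assert (F : forall j s,
    (fun n => ren idr S (if n =? j then s else if j <? n then Var (pred n) else Var n))
    = (fun n => if n =? j then ren idr S s else if j <? n then Var (pred n) else Var n)).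
  { intros. funext. destruct (x =? j); [reflexivity|]. now destruct (j <? x). }
  assert (G : (fun k => renc S idr (idk k)) = idk) by reflexivity.
  apply term_jump_mutind; intros; simpl;
    rewrite ?upk_idk, ?shift_t0, ?shift_k0, ?G, ?E, ?F, ?H, ?H0; reflexivity.
Qed.

Lemma subst_t0 s t : subst_t 0 s t = gsub (scons s Var) idk t.
Proof. rewrite (proj1 subst_t_gsub_mut). f_equal. funext. now destruct x. Qed.
Lemma ssub_gsub_mut :
  (forall t e M, ssub_t e M t
    = gsub Var (fun k => if k =? e then (k, Some M) else (k, None)) t) /\
  (forall J e M, ssub_j e M J
    = gsubj Var (fun k => if k =? e then (k, Some M) else (k, None)) J).
Proof.
  assert (E : forall e M,
    (fun k => renc S idr (if k =? e then (k, Some M) else (k, None)))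
    = (fun k => if k =? e then (k, Some (shift_t 1 M)) else (k, None))).
  { intros. funext. rewrite shift_t1. now destruct (x =? e). }
  assert (F : forall e M,
    upk (fun k => if k =? e then (k, Some M) else (k, None))
    = (fun k => if k =? S e then (k, Some (shift_k 0 M)) else (k, None))).
  { intros. funext. rewrite shift_k0. destruct x; simpl; [reflexivity|].
    destruct (x =? e); [|reflexivity]. unfold renc; simpl. now rewrite upr_idr. }
  apply term_jump_mutind; intros; simpl;
    rewrite ?upt_Var, ?E, ?F, ?H, ?H0; try reflexivity.
  unfold fill. now destruct (n =? e).
Qed.

Lemma ssub_j0 M J : ssub_j 0 M J = gsubj Var (scons (0, Some M) (fun k => idk (S k))) J.
Proof. rewrite (proj2 ssub_gsub_mut). f_equal. funext. now destruct x. Qed.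

(** * Reductions of terms and jumps *)

Lemma ren_shift_t xi zeta t :
  ren (upr xi) zeta (shift_t 0 t) = shift_t 0 (ren xi zeta t).
Proof. rewrite !shift_t0. apply ren_swap; reflexivity. Qed.

Lemma ren_shift_k xi zeta t :
  ren xi (upr zeta) (shift_k 0 t) = shift_k 0 (ren xi zeta t).
Proof. rewrite !shift_k0. apply ren_swap; reflexivity. Qed.

Lemma ren_shift_t1 xi zeta t :
  ren (upr (upr xi)) zeta (shift_t 1 t) = shift_t 1 (ren (upr xi) zeta t).
Proof. rewrite !shift_t1. apply ren_swap; [intros [|n]|]; reflexivity. Qed.

Lemma renj_shift_tj1 xi zeta J :
  renj (upr (upr xi)) zeta (shift_tj 1 J) = shift_tj 1 (renj (upr xi) zeta J).
Proof. rewrite !shift_tj1. apply renj_swap; [intros [|n]|]; reflexivity. Qed.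

Lemma ren_subst_t xi zeta s t :
  ren xi zeta (subst_t 0 s t) = subst_t 0 (ren xi zeta s) (ren (upr xi) zeta t).
Proof.
  rewrite !subst_t0, gsub_ren, ren_gsub. f_equal. funext. now destruct x.
Qed.

Lemma renj_ssub_j xi zeta M J :
  renj xi (upr zeta) (ssub_j 0 (shift_k 0 M) J)
  = ssub_j 0 (shift_k 0 (ren (upr xi) zeta M)) (renj xi (upr zeta) J).
Proof.
  rewrite !ssub_j0, gsubj_renj, renj_gsubj. f_equal. funext.
  destruct x; [|reflexivity]. simpl. unfold renc; simpl. now rewrite ren_shift_k.
Qed.

Lemma renj_rename_kj xi zeta l J :
  renj xi zeta (rename_kj 0 l J) = rename_kj 0 (zeta l) (renj xi (upr zeta) J).
Proof. rewrite !rename_kj0. apply renj_swap; [|intros [|n]]; reflexivity. Qed.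

Lemma is_value_ren xi zeta t : is_value (ren xi zeta t) = is_value t.
Proof. now destruct t. Qed.

Lemma step_ren_mut :
  (forall t t', step_t t t' ->
    forall xi zeta, step_t (ren xi zeta t) (ren xi zeta t')) /\
  (forall J J', step_j J J' ->
    forall xi zeta, step_j (renj xi zeta J) (renj xi zeta J')).
Proof.
  apply (step_mutind
    (fun t t' _ => forall xi zeta, step_t (ren xi zeta t) (ren xi zeta t'))
    (fun J J' _ => forall xi zeta, step_j (renj xi zeta J) (renj xi zeta J')));
    intros; simpl;
    rewrite ?ren_shift_t, ?ren_shift_k, ?ren_subst_t, ?renj_ssub_j, ?renj_rename_kj;
    try (constructor; rewrite ?is_value_ren; auto; fail).
Qed.
Definition step_ren := proj1 step_ren_mut.

Lemma ec_ren_mut :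
  (forall t t', ec_t t t' -> forall xi zeta, ec_t (ren xi zeta t) (ren xi zeta t')) /\
  (forall J J', ec_j J J' ->
    forall xi zeta, ec_j (renj xi zeta J) (renj xi zeta J')).
Proof.
  apply (ec_mutind
    (fun t t' _ => forall xi zeta, ec_t (ren xi zeta t) (ren xi zeta t'))
    (fun J J' _ => forall xi zeta, ec_j (renj xi zeta J) (renj xi zeta J')));
    intros; simpl;
    try (constructor; auto; fail).
  - constructor. destruct e; simpl; rewrite ?ren_shift_t1, ?ren_shift_k; constructor.
  - constructor. destruct e; simpl; rewrite ?renj_shift_tj1; constructor.
Qed.
Definition ec_ren := proj1 ec_ren_mut.

(** * Closures and their compatibility with the term constructors *)

Lemma clos_rt_map {A B} (R : relation A) (S : relation B) (f : A -> B) :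
  (forall a b, R a b -> clos_refl_trans B S (f a) (f b)) ->
  forall a b, clos_refl_trans A R a b -> clos_refl_trans B S (f a) (f b).
Proof.
  intros H a b. induction 1; [auto|apply rt_refl|eapply rt_trans; eassumption].
Qed.

Lemma clos_rst_map {A B} (R : relation A) (S : relation B) (f : A -> B) :
  (forall a b, R a b -> clos_refl_sym_trans B S (f a) (f b)) ->
  forall a b, clos_refl_sym_trans A R a b -> clos_refl_sym_trans B S (f a) (f b).
Proof.
  intros H a b.
  induction 1; [auto|apply rst_refl|now apply rst_sym|eapply rst_trans; eassumption].
Qed.

Definition congj : relation jump := clos_refl_sym_trans jump ec_j.
(** Unlike in [red], a reduction step and a congruence step are separate generators here; this makes
    compatibility with contexts a matter of mapping generators. *)
Definition redt : relation term :=
  clos_refl_trans term (fun a b => step_t a b \/ cong a b).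
Definition redj : relation jump :=
  clos_refl_trans jump (fun a b => step_j a b \/ congj a b).

Lemma redt_reds M N : redt M N -> reds M N.
Proof.
  apply (clos_rt_map _ _ (fun x => x)). intros a b [H|H]; apply rt_step; [left|now right].
  exists a, b. repeat split; auto; apply rst_refl.
Qed.

Lemma cong_map f : (forall a b, ec_t a b -> ec_t (f a) (f b)) ->
  forall a b, cong a b -> cong (f a) (f b).
Proof. intro H. apply clos_rst_map. intros. now apply rst_step, H. Qed.
Lemma congj_map (f : term -> jump) : (forall a b, ec_t a b -> ec_j (f a) (f b)) ->
  forall a b, cong a b -> congj (f a) (f b).
Proof. intro H. apply clos_rst_map. intros. now apply rst_step, H. Qed.

Lemma redt_map (f : term -> term) : (forall a b, step_t a b -> step_t (f a) (f b)) ->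
  (forall a b, ec_t a b -> ec_t (f a) (f b)) ->
  forall a b, redt a b -> redt (f a) (f b).
Proof.
  intros H1 H2. apply clos_rt_map. intros a b [H|H]; apply rt_step; [left; auto|right].
  revert H. now apply cong_map.
Qed.

Lemma redtj_map (f : term -> jump) : (forall a b, step_t a b -> step_j (f a) (f b)) ->
  (forall a b, ec_t a b -> ec_j (f a) (f b)) ->
  forall a b, redt a b -> redj (f a) (f b).
Proof.
  intros H1 H2. apply clos_rt_map. intros a b [H|H]; apply rt_step; [left; auto|right].
  revert H. now apply congj_map.
Qed.

Lemma redt_refl t : redt t t. Proof. apply rt_refl. Qed.
Lemma redj_refl J : redj J J. Proof. apply rt_refl. Qed.
Lemma redt_trans a b c : redt a b -> redt b c -> redt a c.
Proof. apply rt_trans. Qed.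
Lemma redj_trans a b c : redj a b -> redj b c -> redj a c.
Proof. apply rt_trans. Qed.
Lemma step_redt a b : step_t a b -> redt a b.
Proof. intro. apply rt_step. now left. Qed.
Lemma step_redj a b : step_j a b -> redj a b.
Proof. intro. apply rt_step. now left. Qed.
Lemma cong_redt a b : cong a b -> redt a b.
Proof. intro. apply rt_step. now right. Qed.
Lemma congj_redj a b : congj a b -> redj a b.
Proof. intro. apply rt_step. now right. Qed.

Lemma redt_lam a b : redt a b -> redt (Lam a) (Lam b).
Proof. apply redt_map; constructor; assumption. Qed.
Lemma redt_app a b a' b' : redt a a' -> redt b b' -> redt (App a b) (App a' b').
Proof.
  intros H1 H2. apply redt_trans with (App a' b).
  - revert H1. apply (redt_map (fun x => App x b)); constructor; assumption.
  - revert H2. apply redt_map; constructor; assumption.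
Qed.
Lemma congj_wherel J J' t : congj J J' -> congj (JWhere J t) (JWhere J' t).
Proof.
  apply (clos_rst_map _ _ (fun x => JWhere x t)). intros. apply rst_step. now constructor.
Qed.
Lemma cong_mu J J' : congj J J' -> cong (Mu J) (Mu J').
Proof. apply clos_rst_map. intros. apply rst_step. now constructor. Qed.
Lemma redj_jwhere J J' b b' : redj J J' -> redt b b' -> redj (JWhere J b) (JWhere J' b').
Proof.
  intros H1 H2. apply redj_trans with (JWhere J' b).
  - revert H1. apply (clos_rt_map _ _ (fun x => JWhere x b)).
    intros x y [H|H]; apply rt_step; [left; now constructor|right; now apply congj_wherel].
  - revert H2. apply redtj_map; constructor; assumption.
Qed.
Lemma redj_jmp k a b : redt a b -> redj (Jmp k a) (Jmp k b).
Proof. apply redtj_map; constructor; assumption. Qed.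
Lemma redt_mu J J' : redj J J' -> redt (Mu J) (Mu J').
Proof.
  apply clos_rt_map.
  intros x y [H|H]; apply rt_step; [left; now constructor|right; now apply cong_mu].
Qed.
Lemma cong_ren xi zeta a b : cong a b -> cong (ren xi zeta a) (ren xi zeta b).
Proof. apply cong_map. intros. now apply ec_ren. Qed.

(** * Free continuation variables and contraction of mu *)

Definition liftp (P : nat -> Prop) : nat -> Prop := scons True P.

(** A predicate takes the place of a set of free continuation variables: freshness of index 0 is the
    case [k <> 0], and [liftp] imposes no condition on the bound index. *)
Fixpoint allk (P : nat -> Prop) (t : term) : Prop :=
  match t with
  | Var _ => True
  | Lam M => allk P M
  | App M N | Where M N => allk P M /\ allk P N
  | Mu J => allkj (liftp P) J
  end
with allkj (P : nat -> Prop) (J : jump) : Prop :=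
  match J with
  | Jmp k M => P k /\ allk P M
  | JWhere J M => allkj P J /\ allk P M
  end.

Lemma allk_ren_mut :
  (forall t P xi zeta, allk P (ren xi zeta t) = allk (fun k => P (zeta k)) t) /\
  (forall J P xi zeta, allkj P (renj xi zeta J) = allkj (fun k => P (zeta k)) J).
Proof.
  assert (E : forall P zeta,
    (fun k => liftp P (upr zeta k)) = liftp (fun k => P (zeta k))).
  { intros. funext. now destruct x. }
  apply term_jump_mutind; intros; simpl; rewrite ?H, ?H0, ?E; reflexivity.
Qed.
Definition allk_ren := proj1 allk_ren_mut.
Definition allkj_ren := proj2 allk_ren_mut.

Definition allc (P : nat -> Prop) (c : kont) : Prop :=
  P (fst c) /\ match snd c with None => True | Some L => allk P L end.

Lemma allk_true_mut :
  (forall t (P : nat -> Prop), (forall k, P k) -> allk P t) /\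
  (forall J (P : nat -> Prop), (forall k, P k) -> allkj P J).
Proof.
  apply term_jump_mutind; intros; simpl; auto.
  apply H. intros [|k]; simpl; auto.
Qed.

Lemma allk_impl_mut :
  (forall t (P Q : nat -> Prop), (forall k, P k -> Q k) -> allk P t -> allk Q t) /\
  (forall J (P Q : nat -> Prop), (forall k, P k -> Q k) -> allkj P J -> allkj Q J).
Proof.
  apply term_jump_mutind; intros; simpl in *; intuition eauto.
  revert H1. apply H. intros [|k]; simpl; auto.
Qed.

Lemma allc_renc P xi zeta c : allc P (renc xi zeta c) = allc (fun k => P (zeta k)) c.
Proof. destruct c as [l [L|]]; unfold allc; simpl; rewrite ?allk_ren; reflexivity. Qed.

Lemma allk_gsub_mut :
  (forall t (P Q : nat -> Prop) s c,
    (forall n, allk Q (s n)) -> (forall k, P k -> allc Q (c k)) ->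
    allk P t -> allk Q (gsub s c t)) /\
  (forall J (P Q : nat -> Prop) s c,
    (forall n, allk Q (s n)) -> (forall k, P k -> allc Q (c k)) ->
    allkj P J -> allkj Q (gsubj s c J)).
Proof.
  assert (E : forall (P Q : nat -> Prop) s (c : nat -> kont),
    (forall n, allk Q (s n)) -> (forall k, P k -> allc Q (c k)) ->
    (forall n, allk Q (upt s n)) /\ (forall k, P k -> allc Q (renc S idr (c k)))).
  { intros P Q s c H1 H2. split.
    - intros [|n]; simpl; [exact I|]. rewrite allk_ren. apply H1.
    - intros k Hk. rewrite allc_renc. now apply H2. }
  apply term_jump_mutind; intros; simpl in *.
  - apply H.
  - destruct (E _ _ _ _ H0 H1). eapply H; eauto.
  - destruct H3. split; [eapply H|eapply H0]; eauto.
  - destruct (E _ _ _ _ H1 H2). destruct H3. split; [eapply H|eapply H0]; eauto.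
  - eapply H; [| |eassumption].
    + intro k. rewrite allk_ren. apply H0.
    + intros [|k]; simpl; [now split|]. rewrite allc_renc. apply H1.
  - destruct H2 as [Hk Hm]. apply H1 in Hk. unfold fill, allc in *.
    assert (allk Q (gsub s c t)) by (eapply H; eauto).
    destruct (c n) as [l [L|]]; simpl in *; intuition.
  - destruct (E _ _ _ _ H1 H2). destruct H3. split; [eapply H|eapply H0]; eauto.
Qed.

(** Reduction creates no free continuation variable. Hence a contractible mu k.[k]M stays
    contractible while [M] reduces. *)
Lemma allk_step_mut :
  (forall t t', step_t t t' -> forall P, allk P t -> allk P t') /\
  (forall J J', step_j J J' -> forall P, allkj P J -> allkj P J').
Proof.
  apply (step_mutind
    (fun t t' _ => forall P, allk P t -> allk P t')
    (fun J J' _ => forall P, allkj P J -> allkj P J')); intros; simpl in *;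
    rewrite ?shift_t0, ?shift_k0, ?allk_ren in *; simpl in *; intuition eauto.
  - rewrite subst_t0. eapply (proj1 allk_gsub_mut); [| |eassumption].
    + intros [|n]; simpl; auto.
    + unfold allc; simpl; auto.
  - rewrite ssub_j0. eapply (proj2 allk_gsub_mut); [| |eassumption].
    + intro n; simpl; auto.
    + intros [|k]; unfold allc; simpl; auto. rewrite allk_ren. auto.
  - rewrite rename_kj0, allkj_ren. revert H1. apply (proj2 allk_impl_mut).
    intros [|k]; simpl; auto.
Qed.

Lemma allk_ec_mut :
  (forall t t', ec_t t t' -> forall P, allk P t <-> allk P t') /\
  (forall J J', ec_j J J' -> forall P, allkj P J <-> allkj P J').
Proof.
  apply (ec_mutind
    (fun t t' _ => forall P, allk P t <-> allk P t')
    (fun J J' _ => forall P, allkj P J <-> allkj P J')); intros; simpl;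
    try (rewrite ?H; tauto).
  - destruct e; simpl; rewrite ?shift_t1, ?shift_k0, ?allk_ren; [tauto|reflexivity].
  - destruct e; simpl; rewrite ?shift_tj1, ?allkj_ren; [tauto|tauto].
Qed.

Lemma allk_cong P t t' : cong t t' -> (allk P t <-> allk P t').
Proof. induction 1; [now apply allk_ec_mut|tauto|tauto|tauto]. Qed.

Lemma ren_ext_mut :
  (forall t (P : nat -> Prop) xi zeta zeta', (forall k, P k -> zeta k = zeta' k) ->
    allk P t -> ren xi zeta t = ren xi zeta' t) /\
  (forall J (P : nat -> Prop) xi zeta zeta', (forall k, P k -> zeta k = zeta' k) ->
    allkj P J -> renj xi zeta J = renj xi zeta' J).
Proof.
  apply term_jump_mutind; intros; simpl in *; f_equal; intuition eauto.
  eapply H; [|eassumption]. intros [|k] Hk; simpl in *; auto.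
Qed.

Lemma term_eq_dec : forall a b : term, {a = b} + {a <> b}
with jump_eq_dec : forall a b : jump, {a = b} + {a <> b}.
Proof.
  - decide equality. apply Nat.eq_dec.
  - decide equality. apply Nat.eq_dec.
Defined.

Definition freshk (t : term) : Prop := allk (fun k => k <> 0) t.

Lemma freshk_shift t : freshk (ren idr S t).
Proof. unfold freshk. rewrite allk_ren. apply (proj1 allk_true_mut). auto. Qed.

Lemma pred_shift t : ren idr pred (ren idr S t) = t.
Proof. rewrite <- (ren_id t) at 2. now apply ren_ren_comp. Qed.

Lemma freshk_lower t : freshk t -> ren idr S (ren idr pred t) = t.
Proof.
  intro H. rewrite ren_ren. rewrite <- (ren_id t) at 2.
  eapply (proj1 ren_ext_mut); [|eassumption]. unfold idr. simpl. intros; lia.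
Qed.

(** Index 0 is fresh exactly when the term is a shift, and then lowering by [pred] and shifting
    again restores it; a syntactic comparison therefore decides freshness. *)
Lemma freshk_dec t : {freshk t} + {~ freshk t}.
Proof.
  destruct (term_eq_dec (ren idr S (ren idr pred t)) t) as [E|E].
  - left. rewrite <- E. apply freshk_shift.
  - right. intro H. now apply E, freshk_lower.
Defined.

(** With E3 every [where] around a jump moves into its argument, which gives each jump the normal
    form [Jmp (hd J) (bd J)] up to congruence. *)
Fixpoint hd (J : jump) : nat :=
  match J with Jmp k _ => k | JWhere J _ => hd J end.
Fixpoint bd (J : jump) : term :=
  match J with Jmp _ M => M | JWhere J M => Where (bd J) M end.

Lemma hd_bd_cong J : congj J (Jmp (hd J) (bd J)).
Proof.
  induction J; simpl; [apply rst_refl|].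
  apply rst_trans with (JWhere (Jmp (hd J) (bd J)) t).
  - now apply congj_wherel.
  - apply rst_sym, rst_step. constructor. constructor.
Qed.

Lemma hd_renj xi zeta J : hd (renj xi zeta J) = zeta (hd J).
Proof. revert xi zeta. induction J; intros; simpl; auto. Qed.
Lemma bd_renj xi zeta J : bd (renj xi zeta J) = ren xi zeta (bd J).
Proof. revert xi zeta. induction J; intros; simpl; rewrite ?IHJ; auto. Qed.

(* The contraction of [mu k.J] by [mu k.[k]M --> M] when it is possible. *)
Definition smu (J : jump) : term :=
  match hd J with
  | 0 => if freshk_dec (bd J) then ren idr pred (bd J) else Mu J
  | S _ => Mu J
  end.

Variant smu_spec (J : jump) : term -> Prop :=
| smu_lin : forall t, hd J = 0 -> bd J = ren idr S t -> smu_spec J t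
| smu_mu : (hd J = 0 -> ~ freshk (bd J)) -> smu_spec J (Mu J).

Lemma smuP J : smu_spec J (smu J).
Proof.
  unfold smu. destruct (hd J) eqn:E.
  - destruct (freshk_dec (bd J)) as [F|F].
    + apply smu_lin; [assumption|]. now rewrite freshk_lower.
    + now apply smu_mu.
  - apply smu_mu. congruence.
Qed.

Lemma smu_lin_eq J t : hd J = 0 -> bd J = ren idr S t -> smu J = t.
Proof.
  intros H1 H2. unfold smu. rewrite H1, H2.
  destruct (freshk_dec (ren idr S t)) as [F|F].
  - apply pred_shift.
  - destruct F. apply freshk_shift.
Qed.

Lemma smu_jmp t : smu (Jmp 0 (ren idr S t)) = t.
Proof. now apply smu_lin_eq. Qed.

Lemma redt_smu J : redt (Mu J) (smu J).
Proof.
  destruct (smuP J); [|apply redt_refl].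
  apply redt_trans with (Mu (Jmp 0 (ren idr S t))).
  - apply cong_redt, cong_mu. rewrite <- H0, <- H. apply hd_bd_cong.
  - rewrite <- shift_k0. apply step_redt. constructor.
Qed.

(** This holds for arbitrary [zeta]: [upr zeta] sends 0, and nothing else, to 0, so it both
    preserves and reflects the condition for contraction. *)
Lemma smu_renj xi zeta J : smu (renj xi (upr zeta) J) = ren xi zeta (smu J).
Proof.
  destruct (smuP J).
  - apply smu_lin_eq; rewrite ?hd_renj, ?bd_renj.
    + now rewrite H.
    + rewrite H0. apply ren_swap; reflexivity.
  - simpl. unfold smu. rewrite hd_renj, bd_renj. destruct (hd J) eqn:E; [|reflexivity].
    simpl. destruct (freshk_dec (ren xi (upr zeta) (bd J))) as [F|F]; [|reflexivity].
    destruct H; [reflexivity|]. unfold freshk in *. rewrite allk_ren in F.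
    revert F. apply (proj1 allk_impl_mut). intros [|k]; simpl; lia.
Qed.

(** The one rule that changes the head is [r_jmp_mu]. If it fires below some [where], E2 moves these
    inside the [mu], so the body is still congruent to a [mu]. *)
Lemma step_j_hd_bd J J' : step_j J J' ->
  (hd J' = hd J /\ step_t (bd J) (bd J')) \/
  (exists J1, cong (bd J) (Mu J1) /\ J' = rename_kj 0 (hd J) J1).
Proof.
  induction 1; simpl.
  - right. exists J. split; [apply rst_refl|reflexivity].
  - auto.
  - destruct IHstep_j as [[E S]|[J1 [C ->]]].
    + left. split; [assumption|now constructor].
    (* E2 puts [M] under the binder of [mu], whence the shift; the renaming of index 0 cancels it
       afterwards. *)
    + right. exists (JWhere J1 (shift_k 0 M)). split.
      * apply rst_trans with (Where (Mu J1) M).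
        -- revert C. apply (cong_map (fun x => Where x M)). now constructor.
        -- apply rst_step. constructor. constructor.
      * rewrite !rename_kj0. simpl. rewrite upr_idr, shift_k0. f_equal.
        rewrite <- (ren_id M) at 1. symmetry. now apply ren_ren_comp.
  - left. split; [reflexivity|now constructor].
Qed.

Lemma hd_shift_tj1 J : hd (shift_tj 1 J) = hd J.
Proof. rewrite shift_tj1. apply hd_renj. Qed.

(** The normal form is invariant under the congruence: E3 leaves it unchanged, and E1 on jumps
    becomes E1 on bodies. *)
Lemma congj_hd_bd J J' : congj J J' -> hd J' = hd J /\ cong (bd J) (bd J').
Proof.
  induction 1.
  - induction H; simpl.
    + destruct H; simpl; (split; [now rewrite ?hd_shift_tj1|]); [|apply rst_refl].
      apply rst_step. constructor.
      replace (bd (shift_tj 1 J)) with (shift_t 1 (bd J)); [constructor|].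
      rewrite shift_t1, shift_tj1. symmetry. apply bd_renj.
    + split; [reflexivity|]. now apply rst_step.
    + destruct IHec_j. split; [assumption|]. revert H1.
      apply (cong_map (fun x => Where x M)). now constructor.
    + split; [reflexivity|]. apply rst_step. now constructor.
  - split; [reflexivity|apply rst_refl].
  - destruct IHclos_refl_sym_trans. split; [auto|now apply rst_sym].
  - destruct IHclos_refl_sym_trans1, IHclos_refl_sym_trans2.
    split; [congruence|eapply rst_trans; eassumption].
Qed.

(* Contracting [mu k.[k]M] to [M] loses nothing: the jump [[k]M] can only evolve
   by reducing [M], or by becoming [J] when [M] is [mu k.J]. *)
Lemma smu_redj J J' : redj J J' -> redt (smu J) (smu J').
Proof.
  apply clos_rt_map. clear. intros J J' H.
  (* This settles the case where [smu J] is the uncontracted [Mu J]. *)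
  assert (HM : redt (Mu J) (smu J')).
  { eapply redt_trans; [|apply redt_smu]. apply redt_mu, rt_step, H. }
  destruct (smuP J) as [t Hh Hb|_]; [|exact HM].
  assert (Fr : freshk (bd J)) by (rewrite Hb; apply freshk_shift).
  assert (Et : t = ren idr pred (bd J)) by (rewrite Hb, pred_shift; reflexivity).
  assert (K : forall u, freshk (bd J') -> hd J' = 0 -> redt (ren idr pred (bd J)) u ->
    u = ren idr pred (bd J') -> redt t (smu J')).
  { intros u F E R ->. rewrite Et. replace (smu J') with (ren idr pred (bd J')); [exact R|].
    symmetry. apply smu_lin_eq; [assumption|]. now rewrite freshk_lower. }
  destruct H as [H|H].
  - apply step_j_hd_bd in H. destruct H as [[E S]|[J1 [C ->]]].
    + eapply K; [| |apply step_redt, step_ren, S|reflexivity].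
      * eapply allk_step_mut; eassumption.
      * congruence.
    (* Here the body is a [mu] and [[0]] has been renamed into it. The lowering [upr pred] and the
       renaming [scons 0 idr] differ only at index 1, which does not occur since 0 is fresh in the
       body. So the contracted term is already congruent to [Mu J']. *)
    + eapply redt_trans; [|apply redt_smu]. rewrite Et. apply cong_redt.
      apply (cong_ren idr pred) in C as C'. eapply rst_trans; [exact C'|].
      simpl. rewrite Hh, rename_kj0.
      apply (allk_cong (fun k => k <> 0)) in C. apply C in Fr. simpl in Fr.
      rewrite (proj2 ren_ext_mut _ _ idr (upr pred) (scons 0 idr) ) with (2 := Fr).
      * apply rst_refl.
      * intros [|[|k]]; simpl; auto. congruence.
  - apply congj_hd_bd in H. destruct H as [E C].
    eapply K; [| |apply cong_redt, cong_ren, C|reflexivity].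
    + apply (allk_cong (fun k => k <> 0)) in C. now apply C.
    + congruence.
Qed.

(** * The kernel calculus *)

(* [klam] binds an ordinary and a continuation variable, both of index 0 in its
   body; [clam] binds an ordinary variable only. *)
Inductive val : Type :=
| kvar : nat -> val
| klam : cjump -> val
with cjump : Type :=
| jret : cont -> val -> cjump
| jcall : val -> val -> cont -> cjump
with cont : Type :=
| cvar : nat -> cont
| clam : cjump -> cont.

Scheme val_mind := Induction for val Sort Prop
  with cjump_mind := Induction for cjump Sort Prop
  with cont_mind := Induction for cont Sort Prop.
Combined Scheme cps_mutind from val_mind, cjump_mind, cont_mind.

Fixpoint krv (xi zeta : nat -> nat) (v : val) : val :=
  match v with
  | kvar n => kvar (xi n)
  | klam J => klam (krj (upr xi) (upr zeta) J)
  end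
with krj (xi zeta : nat -> nat) (J : cjump) : cjump :=
  match J with
  | jret K V => jret (krc xi zeta K) (krv xi zeta V)
  | jcall V W K => jcall (krv xi zeta V) (krv xi zeta W) (krc xi zeta K)
  end
with krc (xi zeta : nat -> nat) (K : cont) : cont :=
  match K with
  | cvar k => cvar (zeta k)
  | clam J => clam (krj (upr xi) zeta J)
  end.

Definition upv (s : nat -> val) : nat -> val := scons (kvar 0) (fun n => krv S S (s n)).
Definition upc (c : nat -> cont) : nat -> cont := scons (cvar 0) (fun n => krc S S (c n)).
Definition upv1 (s : nat -> val) : nat -> val :=
  scons (kvar 0) (fun n => krv S idr (s n)).
Definition shc (c : nat -> cont) (k : nat) : cont := krc S idr (c k).

Fixpoint ksv (s : nat -> val) (c : nat -> cont) (v : val) : val :=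
  match v with
  | kvar n => s n
  | klam J => klam (ksj (upv s) (upc c) J)
  end
with ksj (s : nat -> val) (c : nat -> cont) (J : cjump) : cjump :=
  match J with
  | jret K V => jret (ksc s c K) (ksv s c V)
  | jcall V W K => jcall (ksv s c V) (ksv s c W) (ksc s c K)
  end
with ksc (s : nat -> val) (c : nat -> cont) (K : cont) : cont :=
  match K with
  | cvar k => c k
  | clam J => clam (ksj (upv1 s) (shc c) J)
  end.

Lemma kr_kr_mut :
  (forall v xi zeta xi' zeta', krv xi' zeta' (krv xi zeta v)
    = krv (fun n => xi' (xi n)) (fun k => zeta' (zeta k)) v) /\
  (forall J xi zeta xi' zeta', krj xi' zeta' (krj xi zeta J)
    = krj (fun n => xi' (xi n)) (fun k => zeta' (zeta k)) J) /\
  (forall K xi zeta xi' zeta', krc xi' zeta' (krc xi zeta K)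
    = krc (fun n => xi' (xi n)) (fun k => zeta' (zeta k)) K).
Proof.
  assert (E : forall xi xi',
    (fun n => upr xi' (upr xi n)) = upr (fun n => xi' (xi n))).
  { intros. funext. destruct x; reflexivity. }
  apply cps_mutind; intros; simpl; rewrite ?H, ?H0, ?H1, ?E; reflexivity.
Qed.
Definition krv_krv := proj1 kr_kr_mut.
Definition krc_krc := proj2 (proj2 kr_kr_mut).

Lemma krv_swap v xi zeta xi' zeta' xi2 zeta2 xi2' zeta2' :
  (forall n, xi' (xi n) = xi2' (xi2 n)) ->
  (forall n, zeta' (zeta n) = zeta2' (zeta2 n)) ->
  krv xi' zeta' (krv xi zeta v) = krv xi2' zeta2' (krv xi2 zeta2 v).
Proof. intros. rewrite !krv_krv. f_equal; funext; auto. Qed.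
Lemma krc_swap v xi zeta xi' zeta' xi2 zeta2 xi2' zeta2' :
  (forall n, xi' (xi n) = xi2' (xi2 n)) ->
  (forall n, zeta' (zeta n) = zeta2' (zeta2 n)) ->
  krc xi' zeta' (krc xi zeta v) = krc xi2' zeta2' (krc xi2 zeta2 v).
Proof. intros. rewrite !krc_krc. f_equal; funext; auto. Qed.

Lemma ks_kr_mut :
  (forall v xi zeta s c, ksv s c (krv xi zeta v)
    = ksv (fun n => s (xi n)) (fun k => c (zeta k)) v) /\
  (forall J xi zeta s c, ksj s c (krj xi zeta J)
    = ksj (fun n => s (xi n)) (fun k => c (zeta k)) J) /\
  (forall K xi zeta s c, ksc s c (krc xi zeta K)
    = ksc (fun n => s (xi n)) (fun k => c (zeta k)) K).
Proof.
  assert (E : forall xi s, (fun n => upv s (upr xi n)) = upv (fun n => s (xi n))).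
  { intros. funext. destruct x; reflexivity. }
  assert (E1 : forall xi s, (fun n => upv1 s (upr xi n)) = upv1 (fun n => s (xi n))).
  { intros. funext. destruct x; reflexivity. }
  assert (E' : forall xi s, (fun n => upc s (upr xi n)) = upc (fun n => s (xi n))).
  { intros. funext. destruct x; reflexivity. }
  apply cps_mutind; intros; simpl; rewrite ?H, ?H0, ?H1, ?E, ?E1, ?E'; reflexivity.
Qed.
Definition ksv_krv := proj1 ks_kr_mut.
Definition ksj_krj := proj1 (proj2 ks_kr_mut).
Definition ksc_krc := proj2 (proj2 ks_kr_mut).

Lemma kr_ks_mut :
  (forall v xi zeta s c, krv xi zeta (ksv s c v)
    = ksv (fun n => krv xi zeta (s n)) (fun k => krc xi zeta (c k)) v) /\
  (forall J xi zeta s c, krj xi zeta (ksj s c J)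
    = ksj (fun n => krv xi zeta (s n)) (fun k => krc xi zeta (c k)) J) /\
  (forall K xi zeta s c, krc xi zeta (ksc s c K)
    = ksc (fun n => krv xi zeta (s n)) (fun k => krc xi zeta (c k)) K).
Proof.
  assert (E : forall xi zeta s, (fun n => krv (upr xi) (upr zeta) (upv s n))
    = upv (fun n => krv xi zeta (s n))).
  { intros. funext. destruct x; [reflexivity|]. apply krv_swap; reflexivity. }
  assert (E1 : forall xi zeta s, (fun n => krv (upr xi) zeta (upv1 s n))
    = upv1 (fun n => krv xi zeta (s n))).
  { intros. funext. destruct x; [reflexivity|]. apply krv_swap; reflexivity. }
  assert (F : forall xi zeta c, (fun n => krc (upr xi) (upr zeta) (upc c n))
    = upc (fun n => krc xi zeta (c n))).
  { intros. funext. destruct x; [reflexivity|]. apply krc_swap; reflexivity. }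
  assert (F1 : forall xi zeta c, (fun n => krc (upr xi) zeta (shc c n))
    = shc (fun n => krc xi zeta (c n))).
  { intros. funext. apply krc_swap; reflexivity. }
  apply cps_mutind; intros; simpl; rewrite ?H, ?H0, ?H1, ?E, ?E1, ?F, ?F1; reflexivity.
Qed.
Definition krv_ksv := proj1 kr_ks_mut.
Definition krj_ksj := proj1 (proj2 kr_ks_mut).
Definition krc_ksc := proj2 (proj2 kr_ks_mut).

Lemma ksv_shift s c v : ksv (upv s) (upc c) (krv S S v) = krv S S (ksv s c v).
Proof. rewrite ksv_krv, krv_ksv. reflexivity. Qed.
Lemma ksc_shift s c K : ksc (upv s) (upc c) (krc S S K) = krc S S (ksc s c K).
Proof. rewrite ksc_krc, krc_ksc. reflexivity. Qed.
Lemma ksv_shift1 s c v : ksv (upv1 s) (shc c) (krv S idr v) = krv S idr (ksv s c v).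
Proof. rewrite ksv_krv, krv_ksv. reflexivity. Qed.
Lemma ksc_shift1 s c K : ksc (upv1 s) (shc c) (krc S idr K) = krc S idr (ksc s c K).
Proof. rewrite ksc_krc, krc_ksc. reflexivity. Qed.

Lemma ks_ks_mut :
  (forall v s c s' c', ksv s' c' (ksv s c v)
    = ksv (fun n => ksv s' c' (s n)) (fun k => ksc s' c' (c k)) v) /\
  (forall J s c s' c', ksj s' c' (ksj s c J)
    = ksj (fun n => ksv s' c' (s n)) (fun k => ksc s' c' (c k)) J) /\
  (forall K s c s' c', ksc s' c' (ksc s c K)
    = ksc (fun n => ksv s' c' (s n)) (fun k => ksc s' c' (c k)) K).
Proof.
  assert (E : forall s c s', (fun n => ksv (upv s') (upc c) (upv s n))
    = upv (fun n => ksv s' c (s n))).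
  { intros. funext. destruct x; [reflexivity|]. apply ksv_shift. }
  assert (E1 : forall s c s', (fun n => ksv (upv1 s') (shc c) (upv1 s n))
    = upv1 (fun n => ksv s' c (s n))).
  { intros. funext. destruct x; [reflexivity|]. apply ksv_shift1. }
  assert (F : forall c s' c', (fun n => ksc (upv s') (upc c') (upc c n))
    = upc (fun n => ksc s' c' (c n))).
  { intros. funext. destruct x; [reflexivity|]. apply ksc_shift. }
  assert (F1 : forall c s' c', (fun n => ksc (upv1 s') (shc c') (shc c n))
    = shc (fun n => ksc s' c' (c n))).
  { intros. funext. apply ksc_shift1. }
  apply cps_mutind; intros; simpl; rewrite ?H, ?H0, ?H1, ?E, ?E1, ?F, ?F1; reflexivity.
Qed.
Definition ksj_ksj := proj1 (proj2 ks_ks_mut).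

Lemma ks_var_mut :
  (forall v xi zeta, ksv (fun n => kvar (xi n)) (fun k => cvar (zeta k)) v = krv xi zeta v) /\
  (forall J xi zeta, ksj (fun n => kvar (xi n)) (fun k => cvar (zeta k)) J = krj xi zeta J) /\
  (forall K xi zeta, ksc (fun n => kvar (xi n)) (fun k => cvar (zeta k)) K = krc xi zeta K).
Proof.
  assert (E : forall xi, upv (fun n => kvar (xi n)) = (fun n => kvar (upr xi n))).
  { intros. funext. now destruct x. }
  assert (E1 : forall xi, upv1 (fun n => kvar (xi n)) = (fun n => kvar (upr xi n))).
  { intros. funext. now destruct x. }
  assert (F : forall xi, upc (fun n => cvar (xi n)) = (fun n => cvar (upr xi n))).
  { intros. funext. now destruct x. }
  assert (F1 : forall xi, shc (fun n => cvar (xi n)) = (fun n => cvar (xi n))).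
  { intros. now funext. }
  apply cps_mutind; intros; simpl;
    rewrite ?E, ?E1, ?F, ?F1, ?H, ?H0, ?H1; reflexivity.
Qed.

Lemma kr_id_mut :
  (forall v, krv idr idr v = v) /\ (forall J, krj idr idr J = J) /\
  (forall K, krc idr idr K = K).
Proof.
  apply cps_mutind; intros; simpl; rewrite ?upr_idr, ?H, ?H0, ?H1; reflexivity.
Qed.

Lemma ksv_id v : ksv kvar cvar v = v.
Proof. rewrite <- (proj1 kr_id_mut v) at 2. apply (proj1 ks_var_mut v idr idr). Qed.
Lemma ksj_id J : ksj kvar cvar J = J.
Proof.
  rewrite <- (proj1 (proj2 kr_id_mut) J) at 2.
  apply (proj1 (proj2 ks_var_mut) J idr idr).
Qed.
Lemma ksc_id K : ksc kvar cvar K = K.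
Proof.
  rewrite <- (proj2 (proj2 kr_id_mut) K) at 2.
  apply (proj2 (proj2 ks_var_mut) K idr idr).
Qed.

(** * Instantiation and parallel reduction of the kernel *)

Definition inst1 (V : val) : cjump -> cjump := ksj (scons V kvar) cvar.
Definition inst2 (V : val) (K : cont) : cjump -> cjump :=
  ksj (scons V kvar) (scons K cvar).

Lemma ksj_inst1 s c V J :
  ksj s c (inst1 V J) = inst1 (ksv s c V) (ksj (upv1 s) (shc c) J).
Proof.
  unfold inst1. rewrite !ksj_ksj. f_equal; funext.
  - destruct x; simpl; [reflexivity|]. rewrite ksv_krv.
    symmetry. apply ksv_id.
  - unfold shc. rewrite ksc_krc. symmetry. apply ksc_id.
Qed.

Lemma ksj_inst2 s c V K J :
  ksj s c (inst2 V K J) = inst2 (ksv s c V) (ksc s c K) (ksj (upv s) (upc c) J).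
Proof.
  unfold inst2. rewrite !ksj_ksj. f_equal; funext.
  - destruct x; simpl; [reflexivity|]. rewrite ksv_krv.
    symmetry. apply ksv_id.
  - destruct x; simpl; [reflexivity|]. rewrite ksc_krc.
    symmetry. apply ksc_id.
Qed.

Lemma krj_inst1 xi zeta V J :
  krj xi zeta (inst1 V J) = inst1 (krv xi zeta V) (krj (upr xi) zeta J).
Proof.
  unfold inst1. rewrite krj_ksj, ksj_krj. f_equal; funext. now destruct x.
Qed.

Lemma krj_inst2 xi zeta V K J :
  krj xi zeta (inst2 V K J)
  = inst2 (krv xi zeta V) (krc xi zeta K) (krj (upr xi) (upr zeta) J).
Proof.
  unfold inst2. rewrite krj_ksj, ksj_krj. f_equal; funext; now destruct x.
Qed.

(** Eta for values mirrors the source eta rule, and eta for continuations mirrors the reduction of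
    [Where (Var 0) M] to [M]. Both state non-occurrence by a shift in the redex, so overlaps require
    inverting shifts. *)
Inductive parv : val -> val -> Prop :=
| p_kvar n : parv (kvar n) (kvar n)
| p_klam J J' : parj J J' -> parv (klam J) (klam J')
| p_etav V V' : parv V V' -> parv (klam (jcall (krv S S V) (kvar 0) (cvar 0))) V'
with parj : cjump -> cjump -> Prop :=
| p_jret K K' V V' : parc K K' -> parv V V' -> parj (jret K V) (jret K' V')
| p_jcall V V' W W' K K' : parv V V' -> parv W W' -> parc K K' ->
    parj (jcall V W K) (jcall V' W' K')
| p_beta1 J J' V V' : parj J J' -> parv V V' ->
    parj (jret (clam J) V) (inst1 V' J')
| p_beta2 J J' V V' K K' : parj J J' -> parv V V' -> parc K K' ->
    parj (jcall (klam J) V K) (inst2 V' K' J')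
with parc : cont -> cont -> Prop :=
| p_cvar k : parc (cvar k) (cvar k)
| p_clam J J' : parj J J' -> parc (clam J) (clam J')
| p_etac K K' : parc K K' -> parc (clam (jret (krc S idr K) (kvar 0))) K'.

Scheme parv_mind := Minimality for parv Sort Prop
  with parj_mind := Minimality for parj Sort Prop
  with parc_mind := Minimality for parc Sort Prop.
Combined Scheme par_mutind from parv_mind, parj_mind, parc_mind.

Lemma par_refl_mut :
  (forall v, parv v v) /\ (forall J, parj J J) /\ (forall K, parc K K).
Proof. apply cps_mutind; intros; constructor; auto. Qed.
Definition parv_refl := proj1 par_refl_mut.
Definition parj_refl := proj1 (proj2 par_refl_mut).
Definition parc_refl := proj2 (proj2 par_refl_mut).

Lemma par_kr_mut :
  (forall v v', parv v v' -> forall xi zeta, parv (krv xi zeta v) (krv xi zeta v')) /\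
  (forall J J', parj J J' -> forall xi zeta, parj (krj xi zeta J) (krj xi zeta J')) /\
  (forall K K', parc K K' -> forall xi zeta, parc (krc xi zeta K) (krc xi zeta K')).
Proof.
  apply par_mutind; intros; simpl; try (constructor; auto; fail).
  - rewrite (krv_swap V S S (upr xi) (upr zeta) xi zeta S S) by reflexivity.
    apply p_etav. auto.
  - rewrite krj_inst1. constructor; auto.
  - rewrite krj_inst2. constructor; auto.
  - rewrite (krc_swap K S idr (upr xi) zeta xi zeta S idr) by reflexivity.
    apply p_etac. auto.
Qed.

Lemma par_ks_mut :
  (forall v v', parv v v' -> forall s s' c c',
    (forall n, parv (s n) (s' n)) -> (forall k, parc (c k) (c' k)) ->
    parv (ksv s c v) (ksv s' c' v')) /\
  (forall J J', parj J J' -> forall s s' c c',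
    (forall n, parv (s n) (s' n)) -> (forall k, parc (c k) (c' k)) ->
    parj (ksj s c J) (ksj s' c' J')) /\
  (forall K K', parc K K' -> forall s s' c c',
    (forall n, parv (s n) (s' n)) -> (forall k, parc (c k) (c' k)) ->
    parc (ksc s c K) (ksc s' c' K')).
Proof.
  assert (Ev : forall s s', (forall n, parv (s n) (s' n)) ->
    forall n, parv (upv s n) (upv s' n)).
  { intros s s' H [|n]; simpl; [constructor|]. now apply par_kr_mut. }
  assert (Ec : forall c c', (forall n, parc (c n) (c' n)) ->
    forall n, parc (upc c n) (upc c' n)).
  { intros s s' H [|n]; simpl; [constructor|]. now apply par_kr_mut. }
  assert (Ev1 : forall s s', (forall n, parv (s n) (s' n)) ->
    forall n, parv (upv1 s n) (upv1 s' n)).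
  { intros s s' H [|n]; simpl; [constructor|]. now apply par_kr_mut. }
  assert (Ec1 : forall c c', (forall n, parc (c n) (c' n)) ->
    forall n, parc (shc c n) (shc c' n)).
  { intros s s' H n. now apply par_kr_mut. }
  apply par_mutind; intros; simpl; auto; try (constructor; auto; fail).
  - rewrite ksv_shift. apply p_etav. auto.
  - rewrite ksj_inst1. apply p_beta1; auto.
  - rewrite ksj_inst2. apply p_beta2; auto.
  - rewrite ksc_shift1. apply p_etac. auto.
Qed.

Lemma par_inst1 J J' V V' : parj J J' -> parv V V' -> parj (inst1 V J) (inst1 V' J').
Proof.
  intros. apply par_ks_mut; [assumption| |constructor].
  intros [|n]; simpl; [assumption|constructor].
Qed.

Lemma par_inst2 J J' V V' K K' : parj J J' -> parv V V' -> parc K K' ->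
  parj (inst2 V K J) (inst2 V' K' J').
Proof.
  intros. apply par_ks_mut; [assumption| |];
    (intros [|n]; simpl; [assumption|constructor]).
Qed.

(* Renaming both ways into the same term factors through the pullback of the two
   renamings; this inverts shifts without a notion of free variable. *)
Definition pullback (x1 x2 r1 r2 : nat -> nat) : Prop :=
  forall m n, x1 m = x2 n -> exists p, m = r1 p /\ n = r2 p.

Lemma pullback_up x1 x2 r1 r2 :
  pullback x1 x2 r1 r2 -> pullback (upr x1) (upr x2) (upr r1) (upr r2).
Proof.
  intros H [|m] [|n]; simpl; intro E; try discriminate.
  - now exists 0.
  - injection E as E. destruct (H _ _ E) as [p [-> ->]]. now exists (S p).
Qed.

Lemma kr_pullback_mut :
  (forall v w x1 x2 r1 r2 z1 z2 q1 q2, pullback x1 x2 r1 r2 -> pullback z1 z2 q1 q2 ->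
    krv x1 z1 v = krv x2 z2 w -> exists u, v = krv r1 q1 u /\ w = krv r2 q2 u) /\
  (forall v w x1 x2 r1 r2 z1 z2 q1 q2, pullback x1 x2 r1 r2 -> pullback z1 z2 q1 q2 ->
    krj x1 z1 v = krj x2 z2 w -> exists u, v = krj r1 q1 u /\ w = krj r2 q2 u) /\
  (forall v w x1 x2 r1 r2 z1 z2 q1 q2, pullback x1 x2 r1 r2 -> pullback z1 z2 q1 q2 ->
    krc x1 z1 v = krc x2 z2 w -> exists u, v = krc r1 q1 u /\ w = krc r2 q2 u).
Proof.
  apply cps_mutind.
  - intros n [m|J] x1 x2 r1 r2 z1 z2 q1 q2 Hx Hz E; [|discriminate].
    injection E as E. destruct (Hx _ _ E) as [p [-> ->]]. now exists (kvar p).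
  - intros J IH [m|J'] x1 x2 r1 r2 z1 z2 q1 q2 Hx Hz E; [discriminate|].
    injection E as E.
    destruct (IH _ _ _ _ _ _ _ _ _ (pullback_up _ _ _ _ Hx) (pullback_up _ _ _ _ Hz) E)
      as [u [-> ->]]. now exists (klam u).
  - intros K IHK V IHV [K' V'|? ? ?] x1 x2 r1 r2 z1 z2 q1 q2 Hx Hz E; [|discriminate].
    injection E as E1 E2.
    destruct (IHK _ _ _ _ _ _ _ _ _ Hx Hz E1) as [u [-> ->]].
    destruct (IHV _ _ _ _ _ _ _ _ _ Hx Hz E2) as [u' [-> ->]].
    now exists (jret u u').
  - intros V IHV W IHW K IHK [? ?|V' W' K'] x1 x2 r1 r2 z1 z2 q1 q2 Hx Hz E;
      [discriminate|].
    injection E as E1 E2 E3.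
    destruct (IHV _ _ _ _ _ _ _ _ _ Hx Hz E1) as [u [-> ->]].
    destruct (IHW _ _ _ _ _ _ _ _ _ Hx Hz E2) as [u' [-> ->]].
    destruct (IHK _ _ _ _ _ _ _ _ _ Hx Hz E3) as [u'' [-> ->]].
    now exists (jcall u u' u'').
  - intros n [m|J] x1 x2 r1 r2 z1 z2 q1 q2 Hx Hz E; [|discriminate].
    injection E as E. destruct (Hz _ _ E) as [p [-> ->]]. now exists (cvar p).
  - intros J IH [m|J'] x1 x2 r1 r2 z1 z2 q1 q2 Hx Hz E; [discriminate|].
    injection E as E.
    destruct (IH _ _ _ _ _ _ _ _ _ (pullback_up _ _ _ _ Hx) Hz E)
      as [u [-> ->]]. now exists (clam u).
Qed.

(** For the eta cases: if a term renamed under a binder is a shift, then the term itself was a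
    shift. *)
Lemma pullback_shift x : pullback (upr x) S S x.
Proof.
  intros [|m] n; simpl; intro E; [discriminate|]. injection E as E. now exists m.
Qed.

Lemma pullback_idr x : pullback x idr idr x.
Proof. intros m n E. now exists m. Qed.

Lemma upr_eq0 x n : 0 = upr x n -> n = 0.
Proof. now destruct n. Qed.

(** Renaming creates no redex, whether or not it is injective: [upr] keeps the bound index apart
    from all others, and the shift in an eta pattern is traced back to the original term by the
    pullback. *)
Lemma par_kr_inv_mut :
  (forall v v', parv v v' -> forall w xi zeta, v = krv xi zeta w ->
    exists w', v' = krv xi zeta w' /\ parv w w') /\
  (forall J J', parj J J' -> forall w xi zeta, J = krj xi zeta w ->
    exists w', J' = krj xi zeta w' /\ parj w w') /\
  (forall K K', parc K K' -> forall w xi zeta, K = krc xi zeta w ->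
    exists w', K' = krc xi zeta w' /\ parc w w').
Proof.
  apply par_mutind.
  - intros n [m|?] xi zeta E; [|discriminate]. exists (kvar m). split; [assumption|constructor].
  - intros J J' _ IH [?|J0] xi zeta E; [discriminate|]. injection E as E.
    destruct (IH _ _ _ E) as [w [-> Hw]]. exists (klam w). split; [reflexivity|now constructor].
  - intros V V' _ IH [?|[? ?|V0 [a|?] [b|?]]] xi zeta E; try discriminate.
    injection E as E Ea Eb. apply upr_eq0 in Ea, Eb. subst.
    symmetry in E.
    destruct (proj1 kr_pullback_mut _ _ _ _ _ _ _ _ _ _
      (pullback_shift xi) (pullback_shift zeta) E) as [u [-> ->]].
    destruct (IH _ _ _ eq_refl) as [w [-> Hw]]. exists w. split; [reflexivity|now constructor].
  - intros K K' V V' _ IHK _ IHV [K0 V0|? ? ?] xi zeta E; [|discriminate].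
    injection E as E1 E2.
    destruct (IHK _ _ _ E1) as [w1 [-> H1]]. destruct (IHV _ _ _ E2) as [w2 [-> H2]].
    exists (jret w1 w2). split; [reflexivity|now constructor].
  - intros V V' W W' K K' _ IHV _ IHW _ IHK [? ?|V0 W0 K0] xi zeta E; [discriminate|].
    injection E as E1 E2 E3.
    destruct (IHV _ _ _ E1) as [w1 [-> H1]]. destruct (IHW _ _ _ E2) as [w2 [-> H2]].
    destruct (IHK _ _ _ E3) as [w3 [-> H3]].
    exists (jcall w1 w2 w3). split; [reflexivity|now constructor].
  - intros J J' V V' _ IHJ _ IHV [[?|J0] V0|? ? ?] xi zeta E; try discriminate.
    injection E as E1 E2.
    destruct (IHJ _ _ _ E1) as [w1 [-> H1]]. destruct (IHV _ _ _ E2) as [w2 [-> H2]].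
    exists (inst1 w2 w1). split; [now rewrite krj_inst1|now constructor].
  - intros J J' V V' K K' _ IHJ _ IHV _ IHK [? ?|[?|J0] V0 K0] xi zeta E; try discriminate.
    injection E as E1 E2 E3.
    destruct (IHJ _ _ _ E1) as [w1 [-> H1]]. destruct (IHV _ _ _ E2) as [w2 [-> H2]].
    destruct (IHK _ _ _ E3) as [w3 [-> H3]].
    exists (inst2 w2 w3 w1). split; [now rewrite krj_inst2|now constructor].
  - intros n [m|?] xi zeta E; [|discriminate]. exists (cvar m). split; [assumption|constructor].
  - intros J J' _ IH [?|J0] xi zeta E; [discriminate|]. injection E as E.
    destruct (IH _ _ _ E) as [w [-> Hw]]. exists (clam w). split; [reflexivity|now constructor].
  - intros V V' _ IH [?|[V0 [a|?]|? ? ?]] xi zeta E; try discriminate.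
    injection E as E Ea. apply upr_eq0 in Ea. subst.
    symmetry in E.
    destruct (proj2 (proj2 kr_pullback_mut) _ _ _ _ _ _ _ _ _ _
      (pullback_shift xi) (pullback_idr zeta) E) as [u [-> ->]].
    destruct (IH _ _ _ eq_refl) as [w [-> Hw]]. exists w. split; [reflexivity|now constructor].
Qed.

Lemma parv_kvar_inv n W : parv (kvar n) W -> W = kvar n.
Proof. now inversion 1. Qed.
Lemma parc_cvar_inv n W : parc (cvar n) W -> W = cvar n.
Proof. now inversion 1. Qed.

(** The beta redex inside the eta expansion of [klam J] contracts back to [J]. *)
Lemma inst2_krj_id J : inst2 (kvar 0) (cvar 0) (krj (upr S) (upr S) J) = J.
Proof.
  unfold inst2. rewrite ksj_krj. rewrite <- (ksj_id J) at 2.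
  f_equal; funext; now destruct x.
Qed.

Lemma inst1_krj_id J : inst1 (kvar 0) (krj (upr S) idr J) = J.
Proof.
  unfold inst1. rewrite ksj_krj. rewrite <- (ksj_id J) at 2.
  f_equal; funext; now destruct x.
Qed.

(** Variables do not reduce, so either the shifted [B] reduces, and the reduct is again a shift, or
    [B] is an abstraction whose application to the two bound variables is contracted. *)
Lemma par_etav_body_inv B J : parj (jcall (krv S S B) (kvar 0) (cvar 0)) J ->
  (exists B', J = jcall (krv S S B') (kvar 0) (cvar 0) /\ parv B B') \/
  (exists J0, B = klam J0 /\ parj J0 J).
Proof.
  intro H. inversion H; subst.
  - match goal with H : parv (kvar 0) _ |- _ => apply parv_kvar_inv in H; subst end.
    match goal with H : parc (cvar 0) _ |- _ => apply parc_cvar_inv in H; subst end.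
    match goal with H : parv (krv S S B) _ |- _ =>
      destruct (proj1 par_kr_inv_mut _ _ H _ _ _ eq_refl) as [w [-> Hw]] end.
    left. eauto.
  - match goal with H : parv (kvar 0) _ |- _ => apply parv_kvar_inv in H; subst end.
    match goal with H : parc (cvar 0) _ |- _ => apply parc_cvar_inv in H; subst end.
    destruct B as [|J1]; [discriminate|]. simpl in *.
    match goal with H : klam _ = klam _ |- _ => injection H as -> end.
    match goal with H : parj (krj _ _ _) _ |- _ =>
      destruct (proj1 (proj2 par_kr_inv_mut) _ _ H _ _ _ eq_refl) as [w [-> Hw]] end.
    right. exists J1. rewrite inst2_krj_id. auto.
Qed.

Lemma par_etac_body_inv B J : parj (jret (krc S idr B) (kvar 0)) J ->
  (exists B', J = jret (krc S idr B') (kvar 0) /\ parc B B') \/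
  (exists J0, B = clam J0 /\ parj J0 J).
Proof.
  intro H. inversion H; subst.
  - match goal with H : parv (kvar 0) _ |- _ => apply parv_kvar_inv in H; subst end.
    match goal with H : parc (krc S idr B) _ |- _ =>
      destruct (proj2 (proj2 par_kr_inv_mut) _ _ H _ _ _ eq_refl) as [w [-> Hw]] end.
    left. eauto.
  - match goal with H : parv (kvar 0) _ |- _ => apply parv_kvar_inv in H; subst end.
    destruct B as [|J1]; [discriminate|]. simpl in *.
    match goal with H : clam _ = clam _ |- _ => injection H as -> end.
    match goal with H : parj (krj _ _ _) _ |- _ =>
      destruct (proj1 (proj2 par_kr_inv_mut) _ _ H _ _ _ eq_refl) as [w [-> Hw]] end.
    right. exists J1. rewrite inst1_krj_id. auto.
Qed.

(** * The diamond property of the kernel *)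

Fixpoint szv (v : val) : nat :=
  match v with kvar _ => 0 | klam J => S (szj J) end
with szj (J : cjump) : nat :=
  match J with
  | jret K V => S (szc K + szv V)
  | jcall V W K => S (szv V + szv W + szc K)
  end
with szc (K : cont) : nat :=
  match K with cvar _ => 0 | clam J => S (szj J) end.

Lemma sz_kr_mut :
  (forall v xi zeta, szv (krv xi zeta v) = szv v) /\
  (forall J xi zeta, szj (krj xi zeta J) = szj J) /\
  (forall K xi zeta, szc (krc xi zeta K) = szc K).
Proof. apply cps_mutind; intros; simpl; auto. Qed.

Definition joins {A} (R : relation A) (a : A) : Prop :=
  forall b c, R a b -> R a c -> exists d, R b d /\ R c d.

Lemma inst2_etav V K B :
  inst2 V K (jcall (krv S S B) (kvar 0) (cvar 0)) = jcall B V K.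
Proof. unfold inst2. simpl. rewrite ksv_krv. simpl. f_equal. apply ksv_id. Qed.
Lemma inst1_etac V B :
  inst1 V (jret (krc S idr B) (kvar 0)) = jret B V.
Proof. unfold inst1. simpl. rewrite ksc_krc. simpl. f_equal. apply ksc_id. Qed.

(* In the overlap of eta with a beta redex, both reducts come from the
   eta-contracted redex, which is smaller but not a subterm; hence the
   induction on the size. *)
Lemma par_joins_mut n :
  (forall v, szv v < n -> joins parv v) /\
  (forall J, szj J < n -> joins parj J) /\
  (forall K, szc K < n -> joins parc K).
Proof.
  induction n as [|n [IHv [IHj IHc]]]; [repeat split; intros; lia|].
  (* Eta contraction on one side, a step inside the eta redex on the other. *)
  assert (Ev : forall V V' J, szv V < n -> parv V V' ->
    parj (jcall (krv S S V) (kvar 0) (cvar 0)) J ->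
    exists W, parv (klam J) W /\ parv V' W).
  { intros V V' J Hs HV HJ. apply par_etav_body_inv in HJ.
    destruct HJ as [[B [-> HB]]|[J0 [-> HJ]]].
    - destruct (IHv V Hs _ _ HV HB) as [W [H1 H2]]. exists W.
      split; [now constructor|assumption].
    - destruct (IHv _ Hs _ _ HV (p_klam _ _ HJ)) as [W [H1 H2]]. eauto. }
  assert (Ec : forall V V' J, szc V < n -> parc V V' ->
    parj (jret (krc S idr V) (kvar 0)) J ->
    exists W, parc (clam J) W /\ parc V' W).
  { intros V V' J Hs HV HJ. apply par_etac_body_inv in HJ.
    destruct HJ as [[B [-> HB]]|[J0 [-> HJ]]].
    - destruct (IHc V Hs _ _ HV HB) as [W [H1 H2]]. exists W.
      split; [now constructor|assumption].
    - destruct (IHc _ Hs _ _ HV (p_clam _ _ HJ)) as [W [H1 H2]]. eauto. }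
  (* Contraction of the beta redex on one side, a step in its parts on the other; the latter may be
     an eta step on the abstraction itself. *)
  assert (Bv : forall J A1 V V1 V2 K K1 K2 J2, szj (jcall (klam J) V K) < S n ->
    parv (klam J) A1 -> parj J J2 -> parv V V1 -> parv V V2 -> parc K K1 -> parc K K2 ->
    exists W, parj (jcall A1 V1 K1) W /\ parj (inst2 V2 K2 J2) W).
  { intros J A1 V V1 V2 K K1 K2 J2 Hs HA HJ HV1 HV2 HK1 HK2. simpl in Hs.
    inversion HA as [|? J1 HJ1|B ? HB]; subst.
    - destruct (IHj J ltac:(lia) _ _ HJ HJ1) as [J3 [? ?]].
      destruct (IHv V ltac:(lia) _ _ HV1 HV2) as [V3 [? ?]].
      destruct (IHc K ltac:(lia) _ _ HK1 HK2) as [K3 [? ?]].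
      exists (inst2 V3 K3 J3). split; [now constructor|now apply par_inst2].
    - simpl in Hs. rewrite (proj1 sz_kr_mut) in Hs.
      apply (IHj (jcall B V K)); [simpl; lia|now constructor|].
      apply par_etav_body_inv in HJ. destruct HJ as [[B' [-> HB']]|[J0 [-> HJ]]].
      + rewrite inst2_etav. now constructor.
      + now constructor. }
  assert (Bc : forall J A1 V V1 V2 J2, szj (jret (clam J) V) < S n ->
    parc (clam J) A1 -> parj J J2 -> parv V V1 -> parv V V2 ->
    exists W, parj (jret A1 V1) W /\ parj (inst1 V2 J2) W).
  { intros J A1 V V1 V2 J2 Hs HA HJ HV1 HV2. simpl in Hs.
    inversion HA as [|? J1 HJ1|B ? HB]; subst.
    - destruct (IHj J ltac:(lia) _ _ HJ HJ1) as [J3 [? ?]].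
      destruct (IHv V ltac:(lia) _ _ HV1 HV2) as [V3 [? ?]].
      exists (inst1 V3 J3). split; [now constructor|now apply par_inst1].
    - simpl in Hs. rewrite (proj2 (proj2 sz_kr_mut)) in Hs.
      apply (IHj (jret B V)); [simpl; lia|now constructor|].
      apply par_etac_body_inv in HJ. destruct HJ as [[B' [-> HB']]|[J0 [-> HJ]]].
      + rewrite inst1_etac. now constructor.
      + now constructor. }
  split; [|split].
  - intros [m|J] Hs b c H1 H2; simpl in Hs.
    + apply parv_kvar_inv in H1, H2. subst. exists (kvar m). split; constructor.
    + inversion H1 as [|? J1 HJ1|B ? HB]; subst; inversion H2 as [|? J2 HJ2|B' ? HB']; subst.
      * destruct (IHj J ltac:(lia) _ _ HJ1 HJ2) as [J3 [? ?]].
        exists (klam J3). split; now constructor.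
      * simpl in Hs. rewrite (proj1 sz_kr_mut) in Hs.
        apply (Ev B' c J1); [lia|assumption|assumption].
      * simpl in Hs. rewrite (proj1 sz_kr_mut) in Hs.
        destruct (Ev B b J2 ltac:(lia) HB HJ2) as [W [? ?]]. eauto.
      * simpl in Hs. rewrite (proj1 sz_kr_mut) in Hs.
        match goal with E : krv S S _ = krv S S _ |- _ => rename E into E0 end.
        (* Two eta contractions of the same redex: shifts are injective, as [S] pulled back along
           itself is the identity, so both start from the same smaller value [u]. *)
        assert (P : pullback S S idr idr).
        { intros x y E. injection E as ->. now exists y. }
        destruct (proj1 kr_pullback_mut _ _ _ _ _ _ _ _ _ _ P P E0) as [u [E1 E2]].
        rewrite (proj1 kr_id_mut) in E1, E2. subst.
        apply (IHv u ltac:(lia) _ _ HB HB').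
  - intros [K V|V W K] Hs b c H1 H2.
    + inversion H1 as [? K1 ? V1 HK1 HV1| |J ? ? ? ? ?|]; subst;
      inversion H2 as [? K2 ? V2 HK2 HV2| |Jb ? ? ? ? ?|]; subst.
      * simpl in Hs.
        destruct (IHc K ltac:(lia) _ _ HK1 HK2) as [K3 [? ?]].
        destruct (IHv V ltac:(lia) _ _ HV1 HV2) as [V3 [? ?]].
        exists (jret K3 V3). split; now constructor.
      * eapply Bc; eassumption.
      * edestruct (Bc J K2 V V2 V') as [W [? ?]]; eauto.
      * simpl in Hs.
        match goal with HA : parj J _, HB : parj J _ |- _ =>
          destruct (IHj J ltac:(lia) _ _ HA HB) as [J3 [? ?]] end.
        match goal with HA : parv V _, HB : parv V _ |- _ =>
          destruct (IHv V ltac:(lia) _ _ HA HB) as [V3 [? ?]] end.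
        exists (inst1 V3 J3). split; now apply par_inst1.
    + inversion H1 as [|? V1 ? W1 ? K1 HV1 HW1 HK1| |J ? ? ? ? ? ? ? ?]; subst;
      inversion H2 as [|? V2 ? W2 ? K2 HV2 HW2 HK2| |Jb ? ? ? ? ? ? ? ?]; subst.
      * simpl in Hs.
        destruct (IHc K ltac:(lia) _ _ HK1 HK2) as [K3 [? ?]].
        destruct (IHv V ltac:(lia) _ _ HV1 HV2) as [V3 [? ?]].
        destruct (IHv W ltac:(lia) _ _ HW1 HW2) as [W3 [? ?]].
        exists (jcall V3 W3 K3). split; now constructor.
      * eapply Bv; eassumption.
      * edestruct (Bv J V2 W W2 V' K K2 K') as [? [? ?]]; eauto.
      * simpl in Hs.
        match goal with HA : parj J _, HB : parj J _ |- _ =>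
          destruct (IHj J ltac:(lia) _ _ HA HB) as [J3 [? ?]] end.
        match goal with HA : parv W _, HB : parv W _ |- _ =>
          destruct (IHv W ltac:(lia) _ _ HA HB) as [V3 [? ?]] end.
        match goal with HA : parc K _, HB : parc K _ |- _ =>
          destruct (IHc K ltac:(lia) _ _ HA HB) as [K3 [? ?]] end.
        exists (inst2 V3 K3 J3). split; now apply par_inst2.
  - intros [m|J] Hs b c H1 H2; simpl in Hs.
    + apply parc_cvar_inv in H1, H2. subst. exists (cvar m). split; constructor.
    + inversion H1 as [|? J1 HJ1|B ? HB]; subst; inversion H2 as [|? J2 HJ2|B' ? HB']; subst.
      * destruct (IHj J ltac:(lia) _ _ HJ1 HJ2) as [J3 [? ?]].
        exists (clam J3). split; now constructor.
      * simpl in Hs. rewrite (proj2 (proj2 sz_kr_mut)) in Hs.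
        apply (Ec B' c J1); [lia|assumption|assumption].
      * simpl in Hs. rewrite (proj2 (proj2 sz_kr_mut)) in Hs.
        destruct (Ec B b J2 ltac:(lia) HB HJ2) as [W [? ?]]. eauto.
      * simpl in Hs. rewrite (proj2 (proj2 sz_kr_mut)) in Hs.
        match goal with E : krc S idr _ = krc S idr _ |- _ => rename E into E0 end.
        assert (P : pullback S S idr idr).
        { intros x y E. injection E as ->. now exists y. }
        destruct (proj2 (proj2 kr_pullback_mut) _ _ _ _ _ _ _ _ _ _ P
          (pullback_idr idr) E0) as [u [E1 E2]].
        rewrite (proj2 (proj2 kr_id_mut)) in E1, E2. subst.
        apply (IHc u ltac:(lia) _ _ HB HB').
Qed.

Lemma parj_joins J : joins parj J.
Proof. apply (proj1 (proj2 (par_joins_mut (S (szj J))))). lia. Qed.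

(** * From the diamond property to Church-Rosser, for an abstract relation *)

Lemma diamond_strip {A} (R : relation A) : (forall a, joins R a) ->
  forall a b, clos_refl_trans A R a b -> forall c, R a c ->
  exists d, R b d /\ clos_refl_trans A R c d.
Proof.
  intros D a b H. induction H as [a b H|a|a b b' _ IH1 _ IH2]; intros c Hc.
  - destruct (D _ _ _ H Hc) as [d [? ?]]. exists d. split; [assumption|now apply rt_step].
  - exists c. split; [assumption|apply rt_refl].
  - destruct (IH1 _ Hc) as [d [H1 H2]]. destruct (IH2 _ H1) as [e [H3 H4]].
    exists e. split; [assumption|eapply rt_trans; eassumption].
Qed.

Lemma diamond_confluent {A} (R : relation A) : (forall a, joins R a) ->
  forall a, joins (clos_refl_trans A R) a.
Proof.
  intros D a b c Hb Hc. revert b Hb.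
  induction Hc as [a c H|a|a c c' _ IH1 _ IH2]; intros b Hb.
  - destruct (diamond_strip R D _ _ Hb _ H) as [d [? ?]].
    exists d. split; [now apply rt_step|assumption].
  - exists b. split; [apply rt_refl|assumption].
  - destruct (IH1 _ Hb) as [d [H1 H2]]. destruct (IH2 _ H2) as [e [H3 H4]].
    exists e. split; [eapply rt_trans; eassumption|assumption].
Qed.

Lemma confluent_church_rosser {A} (R : relation A) : (forall a, joins R a) ->
  forall a b, clos_refl_sym_trans A R a b ->
  exists d, clos_refl_trans A R a d /\ clos_refl_trans A R b d.
Proof.
  intros D a b H. induction H as [a b H|a|a b _ [d [? ?]]|a b c _ [d [H1 H2]] _ [e [H3 H4]]].
  - exists b. split; [now apply rt_step|apply rt_refl].
  - exists a. split; apply rt_refl.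
  - eauto.
  - destruct (diamond_confluent R D _ _ _ H2 H3) as [f [? ?]].
    exists f. split; eapply rt_trans; eassumption.
Qed.

(** * CPS translation *)

Definition shv (s : nat -> val) (n : nat) : val := krv S idr (s n).
Definition shc2 (c : nat -> cont) (k : nat) : cont := krc S S (c k).

(* Values in applications are not let-bound, as the source cannot expand [V W] to
   [(x W where x := V)].  [cpsv] is a junk value on non-values. *)
Fixpoint cps (s : nat -> val) (c : nat -> cont) (t : term) (K : cont) : cjump :=
  match t with
  | Var n => jret K (s n)
  | Lam M => jret K (klam (cps (upv s) (shc2 c) M (cvar 0)))
  | App M N =>
      if is_value M then
        if is_value N then jcall (cpsv s c M) (cpsv s c N) K
        else cps s c N
               (clam (jcall (krv S idr (cpsv s c M)) (kvar 0) (krc S idr K)))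
      else cps s c M (clam (
        if is_value N
        then jcall (kvar 0) (cpsv (shv s) (shc c) N) (krc S idr K)
        else cps (shv s) (shc c) N
               (clam (jcall (kvar 1) (kvar 0) (krc S idr (krc S idr K))))))
  | Where L M => cps s c M (clam (cps (upv1 s) (shc c) L (krc S idr K)))
  | Mu J => cpsj s (scons K c) J
  end
with cpsv (s : nat -> val) (c : nat -> cont) (t : term) : val :=
  match t with
  | Var n => s n
  | Lam M => klam (cps (upv s) (shc2 c) M (cvar 0))
  | _ => kvar 0
  end
with cpsj (s : nat -> val) (c : nat -> cont) (J : jump) : cjump :=
  match J with
  | Jmp k M => cps s c M (c k)
  | JWhere J M => cps s c M (clam (cpsj (upv1 s) (shc c) J))
  end.

(** The second phase of an application, with the operator already evaluated to [v]. It factors the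
    four clauses of [cps] for applications into two independent choices. *)
Definition capp (s : nat -> val) (c : nat -> cont) (v : val) (N : term) (K : cont) :=
  if is_value N then jcall v (cpsv s c N) K
  else cps s c N (clam (jcall (krv S idr v) (kvar 0) (krc S idr K))).

Lemma cps_app s c M N K :
  cps s c (App M N) K =
  if is_value M then capp s c (cpsv s c M) N K
  else cps s c M (clam (capp (shv s) (shc c) (kvar 0) N (krc S idr K))).
Proof. reflexivity. Qed.

Lemma cps_value s c t K : is_value t = true -> cps s c t K = jret K (cpsv s c t).
Proof. destruct t; simpl; intro; try discriminate; reflexivity. Qed.

(** The environments absorb every renaming of the source, so the shifts occurring in rules and
    axioms leave no trace in the kernel. *)
Lemma cps_ren_mut :
  (forall t xi zeta s c,
    (forall K, cps s c (ren xi zeta t) K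
      = cps (fun n => s (xi n)) (fun k => c (zeta k)) t K) /\
    cpsv s c (ren xi zeta t) = cpsv (fun n => s (xi n)) (fun k => c (zeta k)) t) /\
  (forall J xi zeta s c, cpsj s c (renj xi zeta J)
      = cpsj (fun n => s (xi n)) (fun k => c (zeta k)) J).
Proof.
  assert (E : forall xi s, (fun n => upv s (upr xi n)) = upv (fun n => s (xi n))).
  { intros. funext. now destruct x. }
  assert (E1 : forall xi s, (fun n => upv1 s (upr xi n)) = upv1 (fun n => s (xi n))).
  { intros. funext. now destruct x. }
  assert (F : forall zeta K (c : nat -> cont),
    (fun n => scons K c (upr zeta n)) = scons K (fun k => c (zeta k))).
  { intros. funext. now destruct x. }
  apply term_jump_mutind.
  - intros n xi zeta s c. split; reflexivity.
  - intros M IH xi zeta s c. simpl. destruct (IH (upr xi) zeta (upv s) (shc2 c)) as [H _].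
    rewrite E in H. split; intros; now rewrite H.
  - intros M IHM N IHN xi zeta s c. split; [|reflexivity]. intro K. simpl ren.
    rewrite !cps_app, is_value_ren. unfold capp. rewrite !is_value_ren.
    destruct (IHM xi zeta s c) as [-> ->], (IHN xi zeta s c) as [-> ->],
      (IHN xi zeta (shv s) (shc c)) as [-> ->]. reflexivity.
  - intros L IHL M IHM xi zeta s c. split; [|reflexivity]. intro K. simpl.
    destruct (IHM xi zeta s c) as [-> _], (IHL (upr xi) zeta (upv1 s) (shc c)) as [-> _].
    now rewrite E1.
  - intros J IH xi zeta s c. split; [|reflexivity]. intro K. simpl. now rewrite IH, F.
  - intros k M IH xi zeta s c. simpl. now rewrite (proj1 (IH xi zeta s c)).
  - intros J IHJ M IHM xi zeta s c. simpl. now rewrite (proj1 (IHM xi zeta s c)), IHJ, E1.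
Qed.
Lemma cps_ren t xi zeta s c K : cps s c (ren xi zeta t) K
  = cps (fun n => s (xi n)) (fun k => c (zeta k)) t K.
Proof. apply cps_ren_mut. Qed.
Lemma cpsv_ren t xi zeta s c : cpsv s c (ren xi zeta t)
  = cpsv (fun n => s (xi n)) (fun k => c (zeta k)) t.
Proof. apply cps_ren_mut. Qed.
Definition cpsj_renj := proj2 cps_ren_mut.

(** Kernel substitutions act through the environments and the continuation. For [cpsv] the value
    condition excludes the junk [kvar 0], which a substitution would alter. *)
Lemma cps_ks_mut :
  (forall t s' c' s c,
    (forall K, ksj s' c' (cps s c t K)
      = cps (fun n => ksv s' c' (s n)) (fun k => ksc s' c' (c k)) t (ksc s' c' K)) /\
    (is_value t = true -> ksv s' c' (cpsv s c t)
      = cpsv (fun n => ksv s' c' (s n)) (fun k => ksc s' c' (c k)) t)) /\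
  (forall J s' c' s c, ksj s' c' (cpsj s c J)
      = cpsj (fun n => ksv s' c' (s n)) (fun k => ksc s' c' (c k)) J).
Proof.
  assert (E : forall s c s', (fun n => ksv (upv s') (upc c) (upv s n))
    = upv (fun n => ksv s' c (s n))).
  { intros. funext. destruct x; [reflexivity|]. apply ksv_shift. }
  assert (E1 : forall s c s', (fun n => ksv (upv1 s') (shc c) (upv1 s n))
    = upv1 (fun n => ksv s' c (s n))).
  { intros. funext. destruct x; [reflexivity|]. apply ksv_shift1. }
  assert (E2 : forall s c s', (fun n => ksv (upv1 s') (shc c) (shv s n))
    = shv (fun n => ksv s' c (s n))).
  { intros. funext. apply ksv_shift1. }
  assert (F : forall c s' c', (fun n => ksc (upv s') (upc c') (shc2 c n))
    = shc2 (fun n => ksc s' c' (c n))).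
  { intros. funext. apply ksc_shift. }
  assert (F1 : forall c s' c', (fun n => ksc (upv1 s') (shc c') (shc c n))
    = shc (fun n => ksc s' c' (c n))).
  { intros. funext. apply ksc_shift1. }
  assert (F2 : forall s' c' K (c : nat -> cont), (fun k => ksc s' c' (scons K c k))
    = scons (ksc s' c' K) (fun k => ksc s' c' (c k))).
  { intros. funext. now destruct x. }
  apply term_jump_mutind.
  - intros n s' c' s c. split; reflexivity.
  - intros M IH s' c' s c.
    destruct (IH (upv s') (upc c') (upv s) (shc2 c)) as [H _].
    rewrite E, F in H. split; intros; simpl; now rewrite H.
  - intros M IHM N IHN s' c' s c. split; [|discriminate]. intro K.
    assert (A : forall s' c' s c v K, ksj s' c' (capp s c v N K)
      = capp (fun n => ksv s' c' (s n)) (fun k => ksc s' c' (c k)) (ksv s' c' v) N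
          (ksc s' c' K)).
    { clear - IHN. intros s' c' s c v K. unfold capp. destruct (is_value N).
      - simpl. now rewrite (proj2 (IHN s' c' s c) eq_refl).
      - rewrite (proj1 (IHN s' c' s c)). simpl. now rewrite ksv_shift1, ksc_shift1. }
    rewrite !cps_app. destruct (is_value M).
    + rewrite A. now rewrite (proj2 (IHM s' c' s c) eq_refl).
    + rewrite (proj1 (IHM s' c' s c)). simpl. rewrite A. simpl.
      now rewrite E2, F1, ksc_shift1.
  - intros L IHL M IHM s' c' s c. split; [|discriminate]. intro K. simpl.
    rewrite (proj1 (IHM s' c' s c)). simpl.
    rewrite (proj1 (IHL (upv1 s') (shc c') (upv1 s) (shc c))), E1, F1.
    now rewrite ksc_shift1.
  - intros J IH s' c' s c. split; [|discriminate]. intro K. simpl. now rewrite IH, F2.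
  - intros k M IH s' c' s c. simpl. now rewrite (proj1 (IH s' c' s c)).
  - intros J IHJ M IHM s' c' s c. simpl. rewrite (proj1 (IHM s' c' s c)). simpl.
    now rewrite IHJ, E1, F1.
Qed.
Lemma cps_ks t s' c' s c K : ksj s' c' (cps s c t K)
  = cps (fun n => ksv s' c' (s n)) (fun k => ksc s' c' (c k)) t (ksc s' c' K).
Proof. apply cps_ks_mut. Qed.
Lemma cpsv_ks t s' c' s c : is_value t = true -> ksv s' c' (cpsv s c t)
  = cpsv (fun n => ksv s' c' (s n)) (fun k => ksc s' c' (c k)) t.
Proof. apply cps_ks_mut. Qed.
Definition cpsj_ks := proj2 cps_ks_mut.

Lemma capp_ks N s' c' s c v K : ksj s' c' (capp s c v N K)
  = capp (fun n => ksv s' c' (s n)) (fun k => ksc s' c' (c k)) (ksv s' c' v) N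
      (ksc s' c' K).
Proof.
  unfold capp. destruct (is_value N) eqn:E.
  - simpl. now rewrite cpsv_ks.
  - rewrite cps_ks. simpl. now rewrite ksv_shift1, ksc_shift1.
Qed.

Lemma ksv_as_krv xi zeta :
  ksv (fun n => kvar (xi n)) (fun k => cvar (zeta k)) = krv xi zeta.
Proof. funext. apply ks_var_mut. Qed.
Lemma ksc_as_krc xi zeta :
  ksc (fun n => kvar (xi n)) (fun k => cvar (zeta k)) = krc xi zeta.
Proof. funext. apply ks_var_mut. Qed.
Lemma ksj_as_krj xi zeta :
  ksj (fun n => kvar (xi n)) (fun k => cvar (zeta k)) = krj xi zeta.
Proof. funext. apply ks_var_mut. Qed.

Lemma cps_kr t xi zeta s c K : krj xi zeta (cps s c t K)
  = cps (fun n => krv xi zeta (s n)) (fun k => krc xi zeta (c k)) t (krc xi zeta K).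
Proof. rewrite <- ksj_as_krj, <- ksv_as_krv, <- ksc_as_krc. apply cps_ks. Qed.
Lemma cpsv_kr t xi zeta s c : is_value t = true -> krv xi zeta (cpsv s c t)
  = cpsv (fun n => krv xi zeta (s n)) (fun k => krc xi zeta (c k)) t.
Proof. rewrite <- ksv_as_krv, <- ksc_as_krc. apply cpsv_ks. Qed.

(** The kernel continuation denoted by a source context under given environments. *)
Definition kint (s : nat -> val) (c : nat -> cont) (a : kont) : cont :=
  match snd a with
  | None => c (fst a)
  | Some L => clam (cps (upv1 s) (shc c) L (krc S idr (c (fst a))))
  end.

Lemma cpsj_fill s c a t : cpsj s c (fill a t) = cps s c t (kint s c a).
Proof. destruct a as [l [L|]]; reflexivity. Qed.

Lemma kint_renc s c xi zeta a :
  kint s c (renc xi zeta a) = kint (fun n => s (xi n)) (fun k => c (zeta k)) a.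
Proof.
  destruct a as [l [L|]]; unfold kint; simpl; [|reflexivity].
  rewrite cps_ren. f_equal. f_equal. funext. now destruct x.
Qed.

Lemma kint_kr s c xi zeta a : krc xi zeta (kint s c a)
  = kint (fun n => krv xi zeta (s n)) (fun k => krc xi zeta (c k)) a.
Proof.
  destruct a as [l [L|]]; unfold kint; simpl; [|reflexivity].
  rewrite cps_kr. f_equal. f_equal.
  - funext. destruct x; [reflexivity|]. apply krv_swap; reflexivity.
  - funext. apply krc_swap; reflexivity.
  - apply krc_swap; reflexivity.
Qed.

Lemma is_value_gsub s c t :
  (forall n, is_value (s n) = true) -> is_value (gsub s c t) = is_value t.
Proof. intro H. destruct t; simpl; auto. Qed.

(** Structural substitution amounts to reading continuation variables as other continuations, hence
    is invisible to the translation. The substituted terms must be values because [cps] branches on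
    [is_value] and environments hold only kernel values. *)
Lemma cps_gsub_mut :
  (forall t s c, (forall n, is_value (s n) = true) -> forall sg tau,
    (forall K, cps sg tau (gsub s c t) K
      = cps (fun n => cpsv sg tau (s n)) (fun k => kint sg tau (c k)) t K) /\
    cpsv sg tau (gsub s c t)
      = cpsv (fun n => cpsv sg tau (s n)) (fun k => kint sg tau (c k)) t) /\
  (forall J s c, (forall n, is_value (s n) = true) -> forall sg tau,
    cpsj sg tau (gsubj s c J)
      = cpsj (fun n => cpsv sg tau (s n)) (fun k => kint sg tau (c k)) J).
Proof.
  assert (Vu : forall s, (forall n, is_value (s n) = true) ->
    forall n, is_value (upt s n) = true).
  { intros s H [|n]; simpl; [reflexivity|]. now rewrite is_value_ren. }
  assert (Ev : forall s, (forall n, is_value (s n) = true) -> forall sg tau,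
    (fun n => cpsv (upv sg) (shc2 tau) (upt s n)) = upv (fun n => cpsv sg tau (s n))).
  { intros s H sg tau. funext. destruct x; [reflexivity|]. simpl.
    rewrite cpsv_ren, cpsv_kr by apply H. reflexivity. }
  assert (Ev1 : forall s, (forall n, is_value (s n) = true) -> forall sg tau,
    (fun n => cpsv (upv1 sg) (shc tau) (upt s n)) = upv1 (fun n => cpsv sg tau (s n))).
  { intros s H sg tau. funext. destruct x; [reflexivity|]. simpl.
    rewrite cpsv_ren, cpsv_kr by apply H. reflexivity. }
  assert (Es : forall s, (forall n, is_value (s n) = true) -> forall sg tau,
    (fun n => cpsv (shv sg) (shc tau) (s n)) = shv (fun n => cpsv sg tau (s n))).
  { intros s H sg tau. funext. unfold shv at 2. now rewrite cpsv_kr by apply H. }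
  assert (Fv : forall sg tau (c : nat -> kont),
    (fun k => kint (upv sg) (shc2 tau) (renc S idr (c k)))
    = shc2 (fun k => kint sg tau (c k))).
  { intros. funext. unfold shc2 at 2. now rewrite kint_renc, kint_kr. }
  assert (Fv1 : forall sg tau (c : nat -> kont),
    (fun k => kint (upv1 sg) (shc tau) (renc S idr (c k)))
    = shc (fun k => kint sg tau (c k))).
  { intros. funext. unfold shc at 2. now rewrite kint_renc, kint_kr. }
  assert (Fs : forall sg tau (c : nat -> kont),
    (fun k => kint (shv sg) (shc tau) (c k)) = shc (fun k => kint sg tau (c k))).
  { intros. funext. unfold shc at 2. now rewrite kint_kr. }
  apply term_jump_mutind.
  - intros n s c H sg tau. split; [|reflexivity]. intro K. simpl. now apply cps_value.
  - intros M IH s c H sg tau. simpl.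
    destruct (IH _ (fun k => renc S idr (c k)) (Vu _ H) (upv sg) (shc2 tau)) as [E _].
    rewrite (Ev s H), Fv in E. split; intros; now rewrite E.
  - intros M IHM N IHN s c H sg tau. split; [|reflexivity]. intro K. simpl gsub.
    rewrite !cps_app. unfold capp. rewrite !is_value_gsub by assumption.
    destruct (IHM s c H sg tau) as [-> ->], (IHN s c H sg tau) as [-> ->],
      (IHN s c H (shv sg) (shc tau)) as [-> ->].
    now rewrite (Es s H), Fs.
  - intros L IHL M IHM s c H sg tau. split; [|reflexivity]. intro K. simpl.
    destruct (IHM s c H sg tau) as [-> _].
    destruct (IHL _ (fun k => renc S idr (c k)) (Vu _ H) (upv1 sg) (shc tau)) as [-> _].
    now rewrite (Ev1 s H), Fv1.
  - intros J IH s c H sg tau. split; [|reflexivity]. intro K. simpl.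
    rewrite IH by (intro; now rewrite is_value_ren). f_equal; funext.
    + now rewrite cpsv_ren.
    + destruct x; [reflexivity|]. simpl. now rewrite kint_renc.
  - intros k M IH s c H sg tau. simpl. rewrite cpsj_fill. apply (IH s c H).
  - intros J IHJ M IHM s c H sg tau. simpl.
    destruct (IHM s c H sg tau) as [-> _]. rewrite IHJ by now apply Vu.
    now rewrite (Ev1 s H), Fv1.
Qed.

Lemma cps_gsub t s c sg tau K : (forall n, is_value (s n) = true) ->
  cps sg tau (gsub s c t) K
  = cps (fun n => cpsv sg tau (s n)) (fun k => kint sg tau (c k)) t K.
Proof. intro H. now apply cps_gsub_mut. Qed.
Lemma cpsj_gsubj J s c sg tau : (forall n, is_value (s n) = true) ->
  cpsj sg tau (gsubj s c J)
  = cpsj (fun n => cpsv sg tau (s n)) (fun k => kint sg tau (c k)) J.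
Proof. intro H. now apply cps_gsub_mut. Qed.

Lemma cps_par_mut :
  (forall t s s' c c', (forall n, parv (s n) (s' n)) -> (forall k, parc (c k) (c' k)) ->
    (forall K K', parc K K' -> parj (cps s c t K) (cps s' c' t K')) /\
    parv (cpsv s c t) (cpsv s' c' t)) /\
  (forall J s s' c c', (forall n, parv (s n) (s' n)) -> (forall k, parc (c k) (c' k)) ->
    parj (cpsj s c J) (cpsj s' c' J)).
Proof.
  assert (Ev : forall s s', (forall n, parv (s n) (s' n)) ->
    forall n, parv (upv s n) (upv s' n)).
  { intros s s' H [|n]; simpl; [constructor|]. now apply par_kr_mut. }
  assert (Ev1 : forall s s', (forall n, parv (s n) (s' n)) ->
    forall n, parv (upv1 s n) (upv1 s' n)).
  { intros s s' H [|n]; simpl; [constructor|]. now apply par_kr_mut. }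
  assert (Es : forall s s', (forall n, parv (s n) (s' n)) ->
    forall n, parv (shv s n) (shv s' n)).
  { intros s s' H n. now apply par_kr_mut. }
  assert (Ec1 : forall c c', (forall n, parc (c n) (c' n)) ->
    forall n, parc (shc c n) (shc c' n)).
  { intros s s' H n. now apply par_kr_mut. }
  assert (Ec2 : forall c c', (forall n, parc (c n) (c' n)) ->
    forall n, parc (shc2 c n) (shc2 c' n)).
  { intros s s' H n. now apply par_kr_mut. }
  apply term_jump_mutind.
  - intros n s s' c c' Hs Hc. split; simpl; auto. intros. now constructor.
  - intros M IH s s' c c' Hs Hc.
    assert (P : parv (cpsv s c (Lam M)) (cpsv s' c' (Lam M))).
    { simpl. constructor. apply IH; auto. constructor. }
    split; [|exact P]. intros. now constructor.
  - intros M IHM N IHN s s' c c' Hs Hc. split; [|constructor]. intros K K' HK.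
    assert (A : forall s s' c c' v v' K K', (forall n, parv (s n) (s' n)) ->
      (forall k, parc (c k) (c' k)) -> parv v v' -> parc K K' ->
      parj (capp s c v N K) (capp s' c' v' N K')).
    { clear - IHN. intros s s' c c' v v' K K' Hs Hc Hv HK. unfold capp.
      destruct (is_value N).
      - constructor; auto. now apply IHN.
      - apply IHN; auto. constructor.
        constructor; [now apply par_kr_mut|constructor|now apply par_kr_mut]. }
    rewrite !cps_app. destruct (is_value M).
    + apply A; auto. now apply IHM.
    + apply IHM; auto. constructor. apply A; auto; [constructor|now apply par_kr_mut].
  - intros L IHL M IHM s s' c c' Hs Hc. split; [|constructor]. intros K K' HK. simpl.
    apply IHM; auto. constructor. apply IHL; auto. now apply par_kr_mut.
  - intros J IH s s' c c' Hs Hc. split; [|constructor]. intros K K' HK. simpl.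
    apply IH; auto. intros [|k]; simpl; auto.
  - intros k M IH s s' c c' Hs Hc. simpl. now apply IH.
  - intros J IHJ M IHM s s' c c' Hs Hc. simpl. apply IHM; auto. constructor.
    apply IHJ; auto.
Qed.

Lemma cps_parc s c t K K' : parc K K' -> parj (cps s c t K) (cps s c t K').
Proof. intro. apply cps_par_mut; auto using parv_refl, parc_refl. Qed.

Lemma capp_parv s c N K v v' : parv v v' -> parj (capp s c v N K) (capp s c v' N K).
Proof.
  intro H. unfold capp. destruct (is_value N).
  - constructor; auto using parv_refl, parc_refl.
  - apply cps_parc. constructor.
    constructor; [now apply par_kr_mut|constructor|apply parc_refl].
Qed.

(** * Convertibility, and soundness of the translation *)

Definition convv : relation val := clos_refl_sym_trans val parv.
Definition convj : relation cjump := clos_refl_sym_trans cjump parj.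
Definition convc : relation cont := clos_refl_sym_trans cont parc.

Lemma convc_clam J J' : convj J J' -> convc (clam J) (clam J').
Proof. apply clos_rst_map. intros. apply rst_step. now constructor. Qed.
Lemma convv_klam J J' : convj J J' -> convv (klam J) (klam J').
Proof. apply clos_rst_map. intros. apply rst_step. now constructor. Qed.
Lemma cps_convc s c t K K' : convc K K' -> convj (cps s c t K) (cps s c t K').
Proof. apply (clos_rst_map _ _ (cps s c t)). intros. now apply rst_step, cps_parc. Qed.
Lemma capp_convv s c N K v v' : convv v v' -> convj (capp s c v N K) (capp s c v' N K).
Proof.
  apply (clos_rst_map _ _ (fun v => capp s c v N K)). intros. now apply rst_step, capp_parv.
Qed.

(** Both sides of each axiom evaluate the same bound term first and pass it the same continuation.
    Agreement of [is_value] is carried along because the clauses for applications depend on it. *)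
Lemma cps_ec_mut :
  (forall t t', ec_t t t' -> is_value t = is_value t' /\
    (forall s c K, cps s c t K = cps s c t' K) /\
    (forall s c, cpsv s c t = cpsv s c t')) /\
  (forall J J', ec_j J J' -> forall s c, cpsj s c J = cpsj s c J').
Proof.
  apply (ec_mutind
    (fun t t' _ => is_value t = is_value t' /\
      (forall s c K, cps s c t K = cps s c t' K) /\
      (forall s c, cpsv s c t = cpsv s c t'))
    (fun J J' _ => forall s c, cpsj s c J = cpsj s c J')).
  - intros M N [L P Q|J P]; repeat split; intros; simpl.
    + rewrite shift_t1, cps_ren, cps_kr. simpl. do 5 f_equal.
      * funext. destruct x; [reflexivity|]. apply krv_swap; reflexivity.
      * funext. apply krc_swap; reflexivity.
      * apply krc_swap; reflexivity.
    + rewrite shift_k0, cps_ren. simpl. do 3 f_equal. funext. now destruct x.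
  - intros M M' _ [_ [H _]]. repeat split; intros; simpl; now rewrite H.
  - intros M M' N _ [V [H H']]. repeat split; intros. rewrite !cps_app, V, H, H'. reflexivity.
  - intros M N N' _ [V [H H']]. repeat split; intros. rewrite !cps_app. unfold capp.
    rewrite V, !H, !H'. reflexivity.
  - intros L L' M _ [V [H H']]. repeat split; intros. simpl. now rewrite H.
  - intros L M M' _ [V [H H']]. repeat split; intros. simpl. now rewrite H.
  - intros J J' _ H. repeat split; intros. simpl. now rewrite H.
  - intros J J' [L P Q|k L P] s c; simpl; [|reflexivity].
    rewrite shift_tj1, cpsj_renj.
    rewrite <- ksj_as_krj, cpsj_ks, ksv_as_krv, ksc_as_krc.
    do 5 f_equal; funext.
    + destruct x; [reflexivity|]. apply krv_swap; reflexivity.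
    + apply krc_swap; reflexivity.
  - intros k M M' _ [V [H H']] s c. simpl. now rewrite H.
  - intros J J' M _ H s c. simpl. now rewrite H.
  - intros J M M' _ [V [H H']] s c. simpl. now rewrite H.
Qed.

Lemma capp_beta s c v N K :
  inst1 v (capp (shv s) (shc c) (kvar 0) N (krc S idr K)) = capp s c v N K.
Proof.
  unfold inst1. rewrite capp_ks. unfold shv, shc. f_equal; try funext;
    rewrite ?ksv_krv, ?ksc_krc; apply ksv_id || apply ksc_id.
Qed.

Lemma eq_convj J J' : J' = J -> convj J J'.
Proof. intros ->. apply rst_refl. Qed.

Lemma beta1_conv J V : convj (jret (clam J) V) (inst1 V J).
Proof. apply rst_step. constructor; [apply parj_refl|apply parv_refl]. Qed.

Lemma cps_app_value s c M N K : is_value M = true ->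
  convj (cps s c M (clam (capp (shv s) (shc c) (kvar 0) N (krc S idr K))))
        (capp s c (cpsv s c M) N K).
Proof.
  intro H. rewrite cps_value, <- (capp_beta s c (cpsv s c M)) by assumption. apply beta1_conv.
Qed.

(** The delicate case is an operator that becomes a value: the translation switches clauses, and the
    two clauses differ by one administrative beta step. *)
Lemma cps_app_conv s c M M' N K :
  (is_value M = true -> is_value M' = true) ->
  (is_value M = true -> convv (cpsv s c M) (cpsv s c M')) ->
  (forall K, convj (cps s c M K) (cps s c M' K)) ->
  convj (cps s c (App M N) K) (cps s c (App M' N) K).
Proof.
  intros H1 H2 H3. rewrite !cps_app.
  destruct (is_value M) eqn:E; [rewrite H1 by reflexivity; now apply capp_convv, H2|].
  destruct (is_value M') eqn:E'; [|apply H3].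
  eapply rst_trans; [apply H3|now apply cps_app_value].
Qed.

Lemma capp_conv s c v N N' K :
  (is_value N = true -> is_value N' = true) ->
  (is_value N = true -> convv (cpsv s c N) (cpsv s c N')) ->
  (forall K, convj (cps s c N K) (cps s c N' K)) ->
  convj (capp s c v N K) (capp s c v N' K).
Proof.
  intros H1 H2 H3. unfold capp.
  destruct (is_value N) eqn:E.
  - rewrite H1 by reflexivity. generalize (H2 eq_refl).
    apply (clos_rst_map _ _ (fun w => jcall v w K)). intros. apply rst_step.
    constructor; auto using parv_refl, parc_refl.
  - destruct (is_value N') eqn:E'; [|apply H3].
    eapply rst_trans; [apply H3|]. rewrite cps_value by assumption.
    replace (jcall v (cpsv s c N') K)
      with (inst1 (cpsv s c N') (jcall (krv S idr v) (kvar 0) (krc S idr K))).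
    + apply beta1_conv.
    + unfold inst1. simpl. rewrite ksv_krv, ksc_krc.
      f_equal; [apply ksv_id|apply ksc_id].
Qed.

(** The naming rules and all rules about [mu] give equal translations; the others use beta or eta.
    The second conjunct is needed for operators and operands that are values, which enter a call
    directly through [cpsv]. *)
Lemma cps_step_mut :
  (forall t t', step_t t t' ->
    (forall s c K, convj (cps s c t K) (cps s c t' K)) /\
    (is_value t = true ->
      is_value t' = true /\ forall s c, convv (cpsv s c t) (cpsv s c t'))) /\
  (forall J J', step_j J J' -> forall s c, convj (cpsj s c J) (cpsj s c J')).
Proof.
  apply (step_mutind
    (fun t t' _ => (forall s c K, convj (cps s c t K) (cps s c t' K)) /\
      (is_value t = true ->
        is_value t' = true /\ forall s c, convv (cpsv s c t) (cpsv s c t')))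
    (fun J J' _ => forall s c, convj (cpsj s c J) (cpsj s c J'))).
  - intros N M E. split; [|discriminate]. intros s c K.
    rewrite cps_app, E. simpl cps at 2. rewrite shift_t0.
    unfold capp. rewrite is_value_ren, cps_ren, cpsv_ren. apply rst_refl.
  - intros V N E E'. split; [|discriminate]. intros s c K.
    rewrite cps_app, E. unfold capp. rewrite E'. simpl cps at 2.
    rewrite shift_t0, is_value_ren, E, cpsv_ren, cpsv_kr by assumption. apply rst_refl.
  - intros M V E. split; [|discriminate]. intros s c K.
    rewrite cps_app. simpl is_value. unfold capp. rewrite E. simpl.
    rewrite (cps_value s c V) by assumption.
    (* The call contracts to this instance in one step, and so does the translated [where]; the two
       are joined rather than one reduced to the other. *)
    apply rst_trans with (inst2 (cpsv s c V) K (cps (upv s) (shc2 c) M (cvar 0))).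
    + apply rst_step. constructor; auto using parj_refl, parv_refl, parc_refl.
    + apply rst_sym. eapply rst_trans; [apply beta1_conv|].
      unfold inst1, inst2. rewrite !cps_ks. unfold shc2, shc. simpl.
      apply eq_convj.
      f_equal.
      * funext. destruct x; simpl; [reflexivity|]. now rewrite !ksv_krv.
      * funext. rewrite !ksc_krc. reflexivity.
      * rewrite ksc_krc. symmetry. apply ksc_id.
  - intros M V E. split; [|discriminate]. intros s c K. simpl.
    rewrite cps_value, subst_t0 by assumption.
    eapply rst_trans; [apply beta1_conv|].
    rewrite cps_gsub by (intros [|n]; [assumption|reflexivity]).
    unfold inst1. rewrite cps_ks.
    apply eq_convj.
    f_equal.
    + funext. destruct x; simpl; [reflexivity|]. rewrite ksv_krv. symmetry. apply ksv_id.
    + funext. unfold shc. rewrite ksc_krc. symmetry. apply ksc_id.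
    + rewrite ksc_krc. symmetry. apply ksc_id.
  - intros M J. split; [|discriminate]. intros s c K. simpl.
    rewrite ssub_j0, cpsj_gsubj by reflexivity.
    apply eq_convj.
    simpl. f_equal. funext. destruct x; [|reflexivity].
    unfold kint. simpl. now rewrite shift_k0, cps_ren.
  - intros V E. assert (H : forall s c,
      parv (cpsv s c (Lam (App (shift_t 0 V) (Var 0)))) (cpsv s c V)).
    { intros s c. simpl cpsv.
      rewrite shift_t0, is_value_ren, E, cpsv_ren. simpl.
      change (fun k => shc2 c (idr k)) with (fun k => krc S S (c k)).
      rewrite <- cpsv_kr by assumption. constructor. apply parv_refl. }
    split.
    + intros s c K. rewrite (cps_value s c V) by assumption.
      rewrite cps_value by reflexivity.
      apply rst_step. constructor; [apply parc_refl|apply H].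
    + intros _. split; [assumption|]. intros. now apply rst_step.
  - intros M. split; [|discriminate]. intros s c K. simpl.
    apply rst_step, cps_parc. constructor. apply parc_refl.
  - intros M. split; [|discriminate]. intros s c K. simpl.
    rewrite shift_k0, cps_ren. apply rst_refl.
  - intros M M' _ [H _].
    assert (P : forall s c, convv (cpsv s c (Lam M)) (cpsv s c (Lam M'))).
    { intros. simpl. apply convv_klam, H. }
    split; [|auto]. intros s c K. simpl. generalize (P s c). simpl.
    apply (clos_rst_map _ _ (jret K)). intros. apply rst_step.
    constructor; [apply parc_refl|assumption].
  - intros M M' N _ [H H']. split; [|discriminate]. intros s c K.
    apply cps_app_conv; [| |apply H]; intro E; now apply H'.
  - intros M N N' _ [H H']. split; [|discriminate]. intros s c K.
    assert (A : forall s c v K, convj (capp s c v N K) (capp s c v N' K)).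
    { intros. apply capp_conv; [| |apply H]; intro E; now apply H'. }
    rewrite !cps_app. destruct (is_value M); [apply A|].
    apply cps_convc, convc_clam, A.
  - intros L L' M _ [H _]. split; [|discriminate]. intros s c K. simpl.
    apply cps_convc, convc_clam, H.
  - intros L M M' _ [H _]. split; [|discriminate]. intros s c K. simpl. apply H.
  - intros J J' _ H. split; [|discriminate]. intros s c K. simpl. apply H.
  - intros l J s c. simpl. rewrite rename_kj0, cpsj_renj.
    apply eq_convj.
    f_equal. funext. now destruct x.
  - intros k M M' _ [H _] s c. simpl. apply H.
  - intros J J' M _ H s c. simpl. apply cps_convc, convc_clam, H.
  - intros J M M' _ [H _] s c. simpl. apply H.
Qed.

Lemma cps_ccv_eq M N : ccv_eq M N -> forall s c K, convj (cps s c M K) (cps s c N K).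
Proof.
  intros H s c K. revert H. apply (clos_rst_map _ _ (fun t => cps s c t K)).
  intros a b [H|H]; [now apply cps_step_mut|].
  revert H. apply (clos_rst_map _ _ (fun t => cps s c t K)).
  intros a' b' H. apply cps_ec_mut in H as [_ [-> _]]. apply rst_refl.
Qed.

(** * Reading the kernel back *)

(** A continuation is read as the function [gcf K] on terms, which keeps its [where] on the outside
    and so makes the recursion structural. *)
Fixpoint gv (v : val) : term :=
  match v with
  | kvar n => Var n
  | klam J => Lam (smu (gj J))
  end
with gj (J : cjump) : jump :=
  match J with
  | jret K V => gcf K (gv V)
  | jcall V W K => gcf K (App (gv V) (gv W))
  end
with gcf (K : cont) (t : term) : jump :=
  match K with
  | cvar k => Jmp k t
  | clam J => JWhere (gj J) t
  end.

(** The same reading in the normal form that [gsub] accepts as the image of a continuation variable;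
    [gcf_fill] relates the two. *)
Definition gk (K : cont) : kont :=
  match K with
  | cvar k => (k, None)
  | clam J => (hd (gj J), Some (bd (gj J)))
  end.

Lemma is_value_gv v : is_value (gv v) = true.
Proof. now destruct v. Qed.

Lemma g_kr_mut :
  (forall v xi zeta, gv (krv xi zeta v) = ren xi zeta (gv v)) /\
  (forall J xi zeta, gj (krj xi zeta J) = renj xi zeta (gj J)) /\
  (forall K xi zeta t, gcf (krc xi zeta K) (ren xi zeta t) = renj xi zeta (gcf K t)).
Proof.
  apply cps_mutind; intros; simpl.
  - reflexivity.
  - now rewrite H, smu_renj.
  - now rewrite H0, H.
  - rewrite H, H0. apply (H1 xi zeta (App (gv v) (gv v0))).
  - reflexivity.
  - now rewrite H.
Qed.
Definition gv_krv := proj1 g_kr_mut.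
Definition gj_krj := proj1 (proj2 g_kr_mut).

Lemma gk_krc xi zeta K : gk (krc xi zeta K) = renc xi zeta (gk K).
Proof.
  destruct K; simpl; [reflexivity|]. now rewrite gj_krj, hd_renj, bd_renj.
Qed.

Lemma gcf_fill K t : congj (gcf K t) (fill (gk K) t).
Proof.
  destruct K as [k|J]; simpl; [apply rst_refl|].
  eapply rst_trans; [apply congj_wherel, hd_bd_cong|].
  apply rst_sym, rst_step. constructor. constructor.
Qed.

(** A [where] floats out of any evaluation context: by E3 if the context is a plain jump, by E1 on
    jumps otherwise. *)
Lemma gcf_where K A t :
  congj (gcf K (Where A t)) (JWhere (gcf (krc S idr K) A) t).
Proof.
  destruct K as [k|J]; simpl; apply rst_step; constructor.
  - constructor.
  - rewrite gj_krj, <- shift_tj1. constructor.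
Qed.

Lemma redj_gcf K t t' : redt t t' -> redj (gcf K t) (gcf K t').
Proof.
  intro. destruct K; simpl; [now apply redj_jmp|].
  apply redj_jwhere; [apply redj_refl|assumption].
Qed.

Lemma fill_where a b t : congj (fill a (Where b t)) (JWhere (fill (renc S idr a) b) t).
Proof.
  destruct a as [l [L|]]; unfold fill; simpl.
  - apply rst_trans with (Jmp l (Where (Where (shift_t 1 L) b) t)).
    + apply rst_step, ecj_jmp, ec_ax, E1.
    + rewrite shift_t1. apply rst_step. constructor. constructor.
  - apply rst_step. constructor. constructor.
Qed.

Lemma gsubj_hd_bd J s c :
  congj (fill (c (hd J)) (gsub s c (bd J))) (gsubj s c J).
Proof.
  revert s c. induction J; intros; simpl; [apply rst_refl|].
  eapply rst_trans; [apply fill_where|].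
  apply congj_wherel. apply (IHJ (upt s) (fun k => renc S idr (c k))).
Qed.

Lemma hd_bd_gsubj J s c l : c (hd J) = (l, None) ->
  hd (gsubj s c J) = l /\ bd (gsubj s c J) = gsub s c (bd J).
Proof.
  revert s c. induction J; intros s c H; simpl in *.
  - now rewrite H.
  - destruct (IHJ (upt s) (fun k => renc S idr (c k))) as [-> ->]; [now rewrite H|].
    split; reflexivity.
Qed.

(** If the [mu] was contracted, both sides coincide, because its head variable is bound and receives
    no context. Otherwise the left side is still a [mu], and contracting it is itself a
    reduction. *)
Lemma gsub_smu s c J :
  redt (gsub s c (smu J)) (smu (gsubj (fun n => ren idr S (s n)) (upk c) J)).
Proof.
  destruct (smuP J) as [t Hh Hb|_]; [|apply redt_smu].
  destruct (hd_bd_gsubj J (fun n => ren idr S (s n)) (upk c) 0) as [H1 H2];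
    [now rewrite Hh|].
  rewrite (smu_lin_eq _ (gsub s c t)); [apply redt_refl|assumption|].
  now rewrite H2, Hb, gsub_shift_k.
Qed.

Lemma renc_shift_shift a : renc idr S (renc S idr a) = renc S S a.
Proof.
  destruct a as [l [L|]]; unfold renc; simpl; [|reflexivity].
  do 2 f_equal. apply ren_ren_comp; [intros [|n]|]; reflexivity.
Qed.

(** The slack between the two sides comes from contraction ([gsub_smu]) and from the two readings of
    a continuation ([gcf_fill]). *)
Lemma g_ks_mut :
  (forall v s c,
    redt (gsub (fun n => gv (s n)) (fun k => gk (c k)) (gv v)) (gv (ksv s c v))) /\
  (forall J s c,
    redj (gsubj (fun n => gv (s n)) (fun k => gk (c k)) (gj J)) (gj (ksj s c J))) /\
  (forall K s c t,
    redj (gsubj (fun n => gv (s n)) (fun k => gk (c k)) (gcf K t))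
      (gcf (ksc s c K) (gsub (fun n => gv (s n)) (fun k => gk (c k)) t))).
Proof.
  apply cps_mutind.
  - intros n s c. apply redt_refl.
  - intros J IH s c. simpl. apply redt_lam. eapply redt_trans; [apply gsub_smu|].
    apply smu_redj.
    replace (fun n => ren idr S (upt (fun m => gv (s m)) n))
      with (fun n => gv (upv s n)).
    replace (upk (fun k => renc S idr (gk (c k)))) with (fun k => gk (upc c k)).
    + apply IH.
    + funext. destruct x; simpl; [reflexivity|]. now rewrite gk_krc, renc_shift_shift.
    + funext. destruct x; simpl; [reflexivity|].
      rewrite gv_krv. symmetry. now apply ren_ren_comp.
  - intros K IHK V IHV s c. simpl. eapply redj_trans; [apply IHK|].
    now apply redj_gcf.
  - intros V IHV W IHW K IHK s c. simpl. eapply redj_trans; [apply IHK|].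
    apply redj_gcf. now apply redt_app.
  - intros k s c t. simpl. apply congj_redj, rst_sym, gcf_fill.
  - intros J IH s c t. simpl. apply redj_jwhere; [|apply redt_refl].
    replace (upt (fun m => gv (s m))) with (fun n => gv (upv1 s n)).
    replace (fun k => renc S idr (gk (c k))) with (fun k => gk (shc c k)).
    + apply IH.
    + funext. apply gk_krc.
    + funext. destruct x; simpl; [reflexivity|]. apply gv_krv.
Qed.

Lemma eq_redj J J' : J' = J -> redj J J'.
Proof. intros ->. apply redj_refl. Qed.

(** A context with a [where] is first absorbed by [r_where_mu]; then [r_jmp_mu] removes the [mu] by
    renaming its variable to the head of the context. *)
Lemma gcf_mu K J : redj (gcf K (Mu J)) (gsubj Var (scons (gk K) idk) J).
Proof.
  eapply redj_trans; [apply congj_redj, gcf_fill|].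
  assert (R : forall k J, redj (Jmp k (Mu J)) (renj idr (scons k idr) J)).
  { intros. rewrite <- rename_kj0. apply step_redj. constructor. }
  destruct (gk K) as [k [L|]]; unfold fill; simpl.
  - eapply redj_trans; [apply redj_jmp, step_redt, r_where_mu|].
    eapply redj_trans; [apply R|].
    rewrite ssub_j0, renj_gsubj.
    apply eq_redj.
    f_equal. funext. destruct x; [|reflexivity]. unfold renc. simpl.
    rewrite shift_k0. do 2 f_equal. rewrite <- (ren_id L) at 1. symmetry.
    apply ren_ren_comp; [|reflexivity]. intros [|n]; reflexivity.
  - eapply redj_trans; [apply R|].
    apply eq_redj.
    rewrite <- (gsubj_id (renj idr (scons k idr) J)), gsubj_renj.
    f_equal. funext. now destruct x.
Qed.

(** The two substitutions compose: the outer one has a context only at index 0, and the images under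
    [upk c] of the free continuation variables have heads different from 0. *)
Lemma gcf_mu_gsubj K s c J :
  redj (gcf K (Mu (gsubj (fun n => ren idr S (s n)) (upk c) J)))
    (gsubj s (scons (gk K) c) J).
Proof.
  eapply redj_trans; [apply gcf_mu|].
  rewrite (gsubj_gsubj J) with (s2 := s) (c2 := scons (gk K) c); [apply redj_refl| |].
  - intro n. rewrite gsub_ren. apply gsub_id.
  - intros [|k]; [reflexivity|]. simpl.
    destruct (c k) as [l [L|]]; unfold kcomp; simpl; [|reflexivity].
    split; [reflexivity|]. rewrite gsub_ren. rewrite <- (gsub_id L) at 1.
    do 3 f_equal. funext. now destruct x.
Qed.

(** For a contracted [mu] no step is required: [J] is then [[0]t] up to congruence with 0 fresh in
    [t], so substituting for 0 just puts [t] in the context. *)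
Lemma gcf_smu_gsubj K s c J :
  redj (gcf K (gsub s c (smu J))) (gsubj s (scons (gk K) c) J).
Proof.
  destruct (smuP J) as [t Hh Hb|_]; [|apply gcf_mu_gsubj].
  eapply redj_trans; [apply congj_redj, gcf_fill|]. apply congj_redj.
  eapply rst_trans; [|apply gsubj_hd_bd]. rewrite Hh, Hb, gsub_ren. apply rst_refl.
Qed.

(** Only terms have a rule for [where] with a value; the jump is brought to its normal form to
    expose that redex. *)
Lemma jwhere_value J V : is_value V = true ->
  redj (JWhere J V) (gsubj (scons V Var) idk J).
Proof.
  intro H. eapply redj_trans; [apply congj_redj, (hd_bd_cong (JWhere J V))|].
  simpl. eapply redj_trans; [apply redj_jmp, step_redt, r_where_val, H|].
  rewrite subst_t0. apply congj_redj, (gsubj_hd_bd J (scons V Var) idk).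
Qed.

Lemma g_par_mut :
  (forall v v', parv v v' -> redt (gv v) (gv v')) /\
  (forall J J', parj J J' -> redj (gj J) (gj J')) /\
  (forall K K', parc K K' -> forall t, redj (gcf K t) (gcf K' t)).
Proof.
  assert (E : forall V, scons (gv V) Var = (fun n => gv (scons V kvar n))).
  { intro. funext. now destruct x. }
  assert (F : forall K, scons (gk K) idk = (fun k => gk (scons K cvar k))).
  { intro. funext. now destruct x. }
  apply par_mutind; intros; simpl.
  - apply redt_refl.
  - now apply redt_lam, smu_redj.
  (* The body of a kernel eta redex reads back as a jump to its own bound continuation, so [smu]
     contracts it and leaves exactly a source eta redex. *)
  - rewrite (smu_lin_eq _ (App (ren S idr (gv V)) (Var 0))); [|reflexivity|].
    + eapply redt_trans; [|eassumption]. rewrite <- shift_t0.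
      apply step_redt. constructor. apply is_value_gv.
    + simpl. rewrite gv_krv. f_equal. symmetry. now apply ren_ren_comp.
  - eapply redj_trans; [apply H0|]. now apply redj_gcf.
  - eapply redj_trans; [apply H4|]. apply redj_gcf. now apply redt_app.
  - eapply redj_trans; [apply redj_jwhere; eassumption|].
    eapply redj_trans; [apply jwhere_value, is_value_gv|].
    unfold inst1. rewrite E. apply (proj1 (proj2 g_ks_mut) J' _ cvar).
  (* A call takes two source steps, [r_beta] and [r_where_val], after which the body meets the
     context of the call. *)
  - eapply redj_trans; [apply H4|].
    eapply redj_trans; [apply redj_gcf, redt_app;
      [apply redt_lam, smu_redj; eassumption|eassumption]|].
    eapply redj_trans; [apply redj_gcf, step_redt, r_beta, is_value_gv|].
    eapply redj_trans; [apply redj_gcf, step_redt, r_where_val, is_value_gv|].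
    rewrite subst_t0. eapply redj_trans; [apply gcf_smu_gsubj|].
    unfold inst2. rewrite E, F. apply g_ks_mut.
  - apply redj_refl.
  - apply redj_jwhere; [assumption|apply redt_refl].
  (* Up to congruence this continuation wraps its argument as [Where (Var 0) t], and [r_where_var]
     removes the wrapper. *)
  - eapply redj_trans; [|apply H0].
    eapply redj_trans; [apply congj_redj, rst_sym, gcf_where|].
    apply redj_gcf, step_redt, r_where_var.
Qed.

(** This is the administrative part of reduction: operands that are not values are named, each
    [where] floats out, and each [mu] consumes its context. No beta, eta or value substitution takes
    place. *)
Lemma g_cps_mut :
  (forall t s c,
    (forall K, redj (gcf K (gsub (fun n => gv (s n)) (fun k => gk (c k)) t))
      (gj (cps s c t K))) /\
    (is_value t = true ->
      redt (gsub (fun n => gv (s n)) (fun k => gk (c k)) t) (gv (cpsv s c t)))) /\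
  (forall J s c,
    redj (gsubj (fun n => gv (s n)) (fun k => gk (c k)) J) (gj (cpsj s c J))).
Proof.
  assert (E1 : forall s, upt (fun n => gv (s n)) = (fun n => gv (upv1 s n))).
  { intro. funext. destruct x; simpl; [reflexivity|]. now rewrite gv_krv. }
  assert (F1 : forall c, (fun k => renc S idr (gk (c k))) = (fun k => gk (shc c k))).
  { intro. funext. unfold shc. now rewrite gk_krc. }
  assert (Es : forall s, (fun n => ren S idr (gv (s n))) = (fun n => gv (shv s n))).
  { intro. funext. unfold shv. now rewrite gv_krv. }
  assert (W : forall K A A' t J, redj (gcf (krc S idr K) A) (gj A') ->
    redj (gcf (clam A') t) J -> redj (gcf K (Where A t)) J).
  { intros K A A' t J H1 H2. eapply redj_trans; [apply congj_redj, gcf_where|].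
    eapply redj_trans; [|apply H2]. simpl.
    apply redj_jwhere; [assumption|apply redt_refl]. }
  apply term_jump_mutind.
  - intros n s c. split; intros; [apply redj_refl|apply redt_refl].
  - intros M IH s c.
    assert (H : redt (gsub (fun n => gv (s n)) (fun k => gk (c k)) (Lam M))
      (gv (cpsv s c (Lam M)))).
    { simpl. apply redt_lam.
      (* The body cannot reduce to a [mu] around itself; it is instead equal to the contraction of
         that [mu], and [smu_redj] carries the reduction of the jump through the contraction. *)
      rewrite <- (smu_jmp (gsub _ _ M)). apply smu_redj. rewrite ren_gsub.
      destruct (IH (upv s) (shc2 c)) as [H _]. specialize (H (cvar 0)). simpl in H.
      match goal with H : redj ?a _ |- redj ?b _ => replace b with a; [exact H|] end.
      do 2 f_equal; funext.
      - destruct x; simpl; [reflexivity|]. rewrite gv_krv. symmetry. now apply ren_ren_comp.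
      - unfold shc2. now rewrite gk_krc, renc_shift_shift. }
    split; [|auto]. intro K. rewrite cps_value by reflexivity. simpl gj. now apply redj_gcf.
  - intros M IHM N IHN s c. split; [|discriminate]. intro K. rewrite cps_app.
    assert (A : forall s c v K,
      redj (gcf K (App (gv v) (gsub (fun n => gv (s n)) (fun k => gk (c k)) N)))
        (gj (capp s c v N K))).
    { clear - IHN W. intros s c v K. destruct (IHN s c) as [I1 I2]. unfold capp.
      destruct (is_value N) eqn:EN.
      - simpl. apply redj_gcf, redt_app; [apply redt_refl|now apply I2].
      - eapply redj_trans; [apply redj_gcf, step_redt, r_app_vn|].
        + apply is_value_gv.
        + now rewrite is_value_gsub by (intro; apply is_value_gv).
        + eapply W; [|apply I1]. simpl. rewrite gv_krv, shift_t0. apply redj_refl. }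
    destruct (IHM s c) as [I1 I2]. simpl gsub. destruct (is_value M) eqn:EM.
    + eapply redj_trans; [|apply A]. apply redj_gcf, redt_app; [now apply I2|apply redt_refl].
    + eapply redj_trans; [apply redj_gcf, step_redt, r_app_nv|].
      * now rewrite is_value_gsub by (intro; apply is_value_gv).
      * eapply W; [|apply I1]. rewrite shift_t0, ren_gsub, Es, F1. apply (A _ _ (kvar 0)).
  - intros L IHL M IHM s c. split; [|discriminate]. intro K. simpl.
    eapply W; [|apply IHM]. rewrite E1, F1. apply IHL.
  - intros J IH s c. split; [|discriminate]. intro K. simpl.
    eapply redj_trans; [apply gcf_mu_gsubj|].
    replace (scons (gk K) (fun k => gk (c k))) with (fun k => gk (scons K c k)).
    + apply IH.
    + funext. now destruct x.
  - intros k M IH s c. simpl.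
    eapply redj_trans; [apply congj_redj, rst_sym, gcf_fill|]. apply IH.
  - intros J IHJ M IHM s c. simpl. eapply redj_trans; [|apply IHM]. simpl.
    rewrite E1, F1. apply redj_jwhere; [apply IHJ|apply redt_refl].
Qed.

(** Index 0 is reserved for the top-level continuation, so the free continuation variables of [M]
    move up by one. *)
Definition cps_top (M : term) : cjump := cps kvar (fun k => cvar (S k)) M (cvar 0).

Lemma redt_cps_top M Q :
  clos_refl_trans cjump parj (cps_top M) Q -> redt M (smu (gj Q)).
Proof.
  intro H. rewrite <- (smu_jmp M) at 1. apply smu_redj.
  apply redj_trans with (gj (cps_top M)).
  - replace (ren idr S M) with (gsub (fun n => gv (kvar n)) (fun k => gk (cvar (S k))) M).
    + apply (proj1 (proj1 g_cps_mut M kvar (fun k => cvar (S k))) (cvar 0)).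
    + rewrite <- (gsub_id (ren idr S M)), gsub_ren. reflexivity.
  - revert H. apply clos_rt_map. intros. now apply g_par_mut.
Qed.

Theorem theorem2p1 : forall M1 M2 : term,
  ccv_eq M1 M2 -> exists N : term, reds M1 N /\ reds M2 N.
Proof.
  intros M1 M2 H.
  apply cps_ccv_eq with (s := kvar) (c := fun k => cvar (S k)) (K := cvar 0) in H.
  apply (confluent_church_rosser _ parj_joins) in H as [Q [H1 H2]].
  exists (smu (gj Q)). split; apply redt_reds; now apply redt_cps_top.
Qed.
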